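(* For each $k$ put $n:=2^k$, and let either $R_k(t):=|P_k(e^{it})|^2$ for all $k$ or $R_k(t):=|Q_k(e^{it})|^2$ for all $k$. There is an absolute constant $c>0$ such that: (i) for every $\eta\in(0,1]$ there is a $k_\eta$ such that for every $k\geq k_\eta$ the equation $R_k(t)=\eta n$ has at most $c\,\eta^{1/2}n$ solutions (counted with multiplicities) in $K$; (ii) for every $\eta\in[1,2)$ there is a $k_\eta$ such that for every $k\geq k_\eta$ the equation $R_k(t)=\eta n$ has at most $c\,(2-\eta)^{1/2}n$ solutions (counted with multiplicities) in $K$.
   Context: The Rudin-Shapiro polynomials are defined recursively by $P_0(z):=1$, $Q_0(z):=1$, and $$P_{k+1}(z):=P_k(z)+z^{2^k}Q_k(z),\qquad Q_{k+1}(z):=P_k(z)-z^{2^k}Q_k(z),\qquad k=0,1,2,\ldots.$$ Both $P_k$ and $Q_k$ have degree $n-1=2^k-1$. $K:=\mathbb{R}\ (\mathrm{mod}\ 2\pi)$. The multiplicity of a solution $t_0$ of $R_k(t)=\eta n$ is its multiplicity as a zero of the trigonometric polynomial $R_k-\eta n$. *)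

(* Defs.v *)
From mathcomp Require Import all_boot all_order all_algebra.
From mathcomp Require Import complex.
From mathcomp Require Import all_classical all_reals all_analysis.
Import Order.TTheory GRing.Theory Num.Theory.
Import numFieldNormedType.Exports.

Set Implicit Arguments.
Unset Strict Implicit.
Unset Printing Implicit Defensive.

Local Open Scope classical_set_scope.
Local Open Scope ring_scope.
Local Open Scope complex_scope.

Fixpoint rudinP (A : nzRingType) (k : nat) : {poly A} :=
  if k is k'.+1 then rudinP A k' + 'X^(2 ^ k') * rudinQ A k' else 1
with rudinQ (A : nzRingType) (k : nat) : {poly A} :=
  if k is k'.+1 then rudinP A k' - 'X^(2 ^ k') * rudinQ A k' else 1.

Definition expi (R : realType) (t : R) : R[i] := cos t +i* sin t.

(* [`| z |] lives in [R[i]] (with zero imaginary part), hence the [Re]. *)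
Definition sqmod_circle (R : realType) (p : {poly R[i]}) (t : R) : R :=
  complex.Re (`|p.[expi t]| ^+ 2).

(* Order of vanishing of a smooth function at [t]: the least order of a
   nonvanishing derivative, and [+oo] when all derivatives vanish, since the
   infimum of the empty set is [+oo]. *)
Definition zero_mult (R : realType) (f : R -> R) (t : R) : \bar R :=
  ereal_inf [set (j%:R)%:E | j in [set j : nat | derive1n j f t != 0]].

(* For a [2 * pi]-periodic [f], the number of solutions of [f t = y] in
   [R (mod 2 * pi)], counted with multiplicities; each class is represented by
   its element of [0, 2 * pi[, and the value is [+oo] if there are infinitely
   many solutions. *)
Definition nb_solutions (R : realType) (f : R -> R) (y : R) : \bar R :=
  \esum_(t in [set t | 0 <= t < 2 * pi /\ f t = y])
    zero_mult (fun s => f s - y) t.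

(* Main.v *)
Require Import Defs.
From mathcomp Require Import all_boot all_order all_algebra.
From mathcomp Require Import complex ring lra zify polyXY.
From mathcomp Require Import all_classical all_reals all_analysis.
Import Order.TTheory GRing.Theory Num.Theory.
Import numFieldNormedType.Exports.

(* On the unit circle |P_k|^2 + |Q_k|^2 = 2n, so (ii) for one sequence is (i) for
   the other, and it suffices to bound the zeros of R - eta n, where R = |P|^2.

   Upper bounds for the derivatives of R (Bernstein) show that R is at most 2 eta n
   near every cluster of solutions: by Hermite interpolation, m zeros in a window
   of length m w, with w of order sqrt eta / n, force |R - eta n| to be small on
   the window. Spreading the solutions greedily, N of them, counted with
   multiplicities, produce N disjoint intervals of length w on which R <= 2 eta n.

   On the other hand this set has measure O(eta): the moments of |P_k|^2 / 2n
   converge to those of the uniform law on [0, 1], and (1 - R / 2n)^M with M of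
   order 1 / eta is at least 1/2 on the set and has mean about 1 / (M + 1). Hence
   N w = O(eta), that is N = O(sqrt eta n).

   For the moments, the Fourier coefficients of the forms of degree m in P_k, Q_k
   and their conjugates, at multiples of 2^k, obey a linear recursion in k governed
   by the Krawtchouk matrix. Its quadratic energy decreases, and the energy that is
   lost must tend to 0; together with the symmetries of the Krawtchouk matrix this
   forces all the coefficients but the diagonal mean values to vanish in the limit,
   and determines these. *)

Set Implicit Arguments.
Unset Strict Implicit.
Unset Printing Implicit Defensive.

Local Open Scope classical_set_scope.
Local Open Scope ring_scope.


(* Krawtchouk numbers: the action of (x, y) |-> (x + y, x - y) on the forms
   x^(m - i) y^i of degree m. *)
Definition kraw (m i a : nat) : int :=
  ((1 + 'X) ^+ (m - i) * (1 - 'X) ^+ i : {poly int})`_a.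

(** * Krawtchouk numbers: involution, reversal and weighted symmetry *)

Section Krawtchouk.

(** This is u^m p(v / u), written without division. *)
Definition homog (B : comNzRingType) (m : nat) (p : {poly int}) (u v : B) : B :=
  \sum_(a < m.+1) (p`_a)%:~R * (u ^+ (m - a) * v ^+ a).

Lemma homog_mul_linear (B : comNzRingType) m (p : {poly int}) (s : int) (u v : B) :
  (size p <= m.+1)%N ->
  homog m.+1 ((1 + s *: 'X) * p) u v = (u + s%:~R * v) * homog m p u v.
Proof.
move=> sp; rewrite /homog [RHS]mulrDl.
have -> : \sum_(a < m.+2) (((1 + s *: 'X) * p)`_a)%:~R * (u ^+ (m.+1 - a) * v ^+ a)
  = \sum_(a < m.+2) (p`_a)%:~R * (u ^+ (m.+1 - a) * v ^+ a)
  + \sum_(a < m.+2) s%:~R * (('X * p)`_a)%:~R * (u ^+ (m.+1 - a) * v ^+ a).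
  rewrite -big_split /=; apply: eq_bigr => a _.
  by rewrite mulrDl mul1r -scalerAl coefD coefZ rmorphD rmorphM /= mulrDl.
congr (_ + _).
- rewrite big_ord_recr /= nth_default // mul0r addr0 mulr_sumr.
  apply: eq_bigr => a _; rewrite subSn; last by rewrite -ltnS.
  by rewrite exprS; ring.
- rewrite big_ord_recl /= coefXM /= mulr0 mul0r add0r mulr_sumr.
  apply: eq_bigr => a _; rewrite /bump /= add1n coefXM /= subSS exprS; ring.
Qed.

Lemma kraw_homog (B : comNzRingType) m i (u v : B) : (i <= m)%N ->
  \sum_(a < m.+1) (kraw m i a)%:~R * (u ^+ (m - a) * v ^+ a) =
  (u + v) ^+ (m - i) * (u - v) ^+ i.
Proof.
move=> le_im.
(* The size bound is carried along because [homog] drops all coefficients above its degree. *)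
suff key (j l : nat) : (size ((1 + 'X) ^+ j * (1 - 'X) ^+ l : {poly int})%R
                <= (j + l).+1)%N /\
    homog (j + l) ((1 + 'X) ^+ j * (1 - 'X) ^+ l) u v =
      (u + v) ^+ j * (u - v) ^+ l.
  by have [_] := key (m - i)%N i; rewrite subnK.
have size_lin (s : int) (p : {poly int}) d : (size p <= d.+1)%N ->
    (size ((1 + s *: 'X) * p)%R <= d.+2)%N.
  move=> sp; apply: leq_trans (size_polyMleq _ _) _.
  have s2 : (size (1 + s *: 'X : {poly int})%R <= 2)%N.
    apply: leq_trans (size_polyD _ _) _; rewrite geq_max size_poly1 /=.
    by apply: leq_trans (size_scale_leq _ _) _; rewrite size_polyX.
  by case: (_ + _)%N (leq_add s2 sp).
have eP : (1 + 'X : {poly int}) = 1 + 1 *: 'X by rewrite scale1r.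
have eM : (1 - 'X : {poly int}) = 1 + (-1) *: 'X by rewrite scaleN1r.
elim: j => [|j [sj ej]].
  rewrite add0n !expr0 !mul1r; elim: l => [|l [sl el]].
    rewrite expr0 size_poly1; split=> //.
    by rewrite /homog big_ord_recl big_ord0 /= coef1 !expr0 !mulr1 addr0.
  rewrite !exprS eM; split; first by apply: size_lin; rewrite -eM.
  by rewrite homog_mul_linear -?eM // el rmorphN1 mulN1r.
rewrite addSn !exprS -!mulrA eP; split; first by apply: size_lin; rewrite -eP.
by rewrite homog_mul_linear -?eP // ej mul1r.
Qed.

(** Applying (x, y) |-> (x + y, x - y) twice doubles both variables; the identity is read off at u =
    1 + X, v = 1 - X. *)
Lemma kraw_involutive m i b : (i <= m)%N -> (b <= m)%N ->
  \sum_(a < m.+1) kraw m i a * kraw m a b = (2 ^+ m) *+ (i == b).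
Proof.
move=> le_im le_bm.
have /(congr1 (fun p : {poly int} => p`_b)) :=
  kraw_homog (1 + 'X : {poly int}) (1 - 'X) le_im.
rewrite coef_sum => E.
have {E} -> : \sum_(a < m.+1) kraw m i a * kraw m a b =
  ((1 + 'X + (1 - 'X)) ^+ (m - i) * (1 + 'X - (1 - 'X)) ^+ i : {poly int})`_b.
  rewrite -E; apply: eq_bigr => a _.
  by rewrite mulrzl -scaler_int intz coefZ.
have -> : (1 + 'X + (1 - 'X) : {poly int}) = (2 : int)%:P by rewrite polyCD; ring.
have -> : (1 + 'X - (1 - 'X) : {poly int}) = (2 : int)%:P * 'X by rewrite polyCD; ring.
rewrite exprMn mulrA -exprD subnK // -polyC_exp coefCM coefXn eq_sym.
by rewrite mulr_natr.
Qed.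

(** Exchanging the factors 1 + X and 1 - X of the generating polynomial amounts to replacing X by
    -X. *)
Lemma kraw_rev m i a : (i <= m)%N -> (a <= m)%N ->
  kraw m (m - i) a = (-1) ^+ a * kraw m i a.
Proof.
move=> le_im le_am.
have := kraw_homog (1 : {poly int}) (- 'X) le_im.
have := kraw_homog (1 : {poly int}) 'X (leq_subr i m).
rewrite opprK subKn // [X in _ = X -> _]mulrC => <-.
move=> /(congr1 (fun p : {poly int} => p`_a)); rewrite !coef_sum.
have get (s : int) j : \sum_(b < m.+1)
    ((kraw m j b)%:~R * (1 ^+ (m - b) * (s *: 'X) ^+ b) : {poly int})`_a
    = s ^+ a * kraw m j a.
  rewrite (bigD1 (Ordinal (le_am : a < m.+1)%N)) //= big1 ?addr0.
    by rewrite expr1n mul1r exprZn mulrzl -scaler_int intz !coefZ coefXn eqxx mulr1 mulrC.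
  move=> b nb; rewrite expr1n mul1r exprZn mulrzl -scaler_int intz !coefZ coefXn.
  case: eqP => [ab|_]; last by rewrite !mulr0.
  by case/eqP: nb; apply/val_inj.
have := get 1 (m - i)%N; rewrite scale1r expr1n mul1r => ->.
by have := get (-1) i; rewrite scaleN1r => -> <-.
Qed.

(** Both sides are coefficients of (1 + X + Y - X Y)^m, which is symmetric in X and Y. *)
Lemma kraw_bin_sym m i a : (i <= m)%N -> (a <= m)%N ->
  kraw m i a *+ 'C(m, i) = kraw m a i *+ 'C(m, a).
Proof.
pose G : {poly {poly int}} := ((1 + 'X)%:P + (1 - 'X)%:P * 'X) ^+ m.
have coG i' a' : (i' <= m)%N -> G`_i'`_a' = kraw m i' a' *+ 'C(m, i').
  move=> le_im; rewrite /G exprDn coef_sum.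
  rewrite (bigD1 (Ordinal (le_im : i' < m.+1)%N)) //= big1 ?addr0.
    by rewrite exprMn mulrA -!polyC_exp -polyCM coefMn coefCM coefXn eqxx mulr1 coefMn.
  move=> b nb; rewrite exprMn mulrA -!polyC_exp -polyCM coefMn coefCM coefXn.
  case: eqP => [ab|_]; last by rewrite mulr0 mul0rn.
  by case/eqP: nb; apply/val_inj.
have swG : swapXY G = G.
  rewrite /G rmorphXn /=; congr (_ ^+ _).
  rewrite rmorphD rmorphM /= swapXY_X !swapXY_polyC !rmorphD !rmorphN /=.
  by rewrite !rmorph1 /= !map_polyX; ring.
move=> le_im le_am; rewrite -coG // -{1}swG coef_swapXY; exact: coG.
Qed.

End Krawtchouk.


(** * Sequences tending to 0 *)

Section NullSequences.
Variable R : realType.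

Definition null (u : nat -> R) := u k @[k --> \oo] --> (0 : R).

Lemma null0 : null (fun=> 0).
Proof. exact: cvg_cst. Qed.

Lemma nullD u v : null u -> null v -> null (fun k => u k + v k).
Proof. by move=> hu hv; rewrite /null -(addr0 0); apply: cvgD. Qed.

Lemma nullZ c u : null u -> null (fun k => c * u k).
Proof. by move=> hu; rewrite /null -(mulr0 c); apply: cvgM => //; exact: cvg_cst. Qed.

Lemma nullB u v : null u -> null v -> null (fun k => u k - v k).
Proof.
move=> hu hv; apply: nullD => //.
by under eq_fun do rewrite -mulN1r; apply: nullZ.
Qed.

Lemma null_sum (I : Type) (r : seq I) (P : pred I) (u : I -> nat -> R) :
  (forall i, P i -> null (u i)) -> null (fun k => \sum_(i <- r | P i) u i k).
Proof.
move=> hu; elim: r => [|i r IH].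
  by under eq_fun do rewrite big_nil; exact: null0.
have [Pi|/negbTE Pi] := boolP (P i); last by under eq_fun do rewrite big_cons Pi.
by under eq_fun do rewrite big_cons Pi; apply: nullD => //; exact: hu.
Qed.

Lemma null_squeeze u v : (forall k, `|u k| <= v k) -> null v -> null u.
Proof.
move=> uv hv; apply/norm_cvg0P.
apply: (@squeeze_cvgr _ _ _ _ (fun=> 0) v) => //; last exact: cvg_cst.
by near=> k; rewrite normr_ge0 uv.
Unshelve. all: by end_near. Qed.

Lemma null_shiftS u : null u -> null (fun k => u k.+1).
Proof. by move=> hu; rewrite /null (cvg_shiftS u). Qed.

Lemma null_ofS u : null (fun k => u k.+1) -> null u.
Proof. by rewrite /null (cvg_shiftS u). Qed.

Lemma ler_sum_supp (s r : seq int) (g : int -> R) : uniq s ->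
  (forall c, 0 <= g c) -> (forall c, c \in s -> g c != 0 -> c \in r) ->
  \sum_(c <- s) g c <= \sum_(c <- r) g c.
Proof.
move=> us g0; elim: r s us => [|x r IH] s us sr.
  rewrite big_nil big_seq big1 // => c cs.
  by apply/eqP/negP => /negP/(sr _ cs); rewrite in_nil.
rewrite big_cons.
have [xs|xs] := boolP (x \in s).
  rewrite (big_rem x) //= lerD2l; apply: IH; first exact: rem_uniq.
  move=> c; rewrite mem_rem_uniq // inE => /andP[/= cx cs] /(sr _ cs).
  by rewrite inE (negbTE cx).
rewrite -[leLHS]add0r lerD //; apply: IH => // c cs /(sr _ cs).
by rewrite inE => /orP[/eqP cx|//]; rewrite -cx cs in xs.
Qed.

End NullSequences.

(** * The correlation recursion and its decreasing energy *)

Section CorrelationArrays.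
Variables (R : realType) (m : nat).

Definition krawmx : 'M[R]_m.+1 := \matrix_(i, a) (kraw m i a)%:~R.

(* [corr k c a b] is the mean of P^(m-a) Q^a conj(P^(m-b) Q^b) z^(- 2^k c) over
   the circle, for P and Q the k-th polynomials, divided by 2^((k+1)m). *)
Fixpoint corr (k : nat) (c : int) : 'M[R]_m.+1 :=
  if k is k'.+1 then
    (2 ^+ m)^-1 *: (krawmx *m
      (\matrix_(a, b) corr k' (c * 2 - a%:Z + b%:Z) a b) *m krawmx^T)
  else (2 ^- m *+ (c == 0)) *: const_mx 1.

(** Passing from level k to k + 1 gives the a-th form the factor z^(2^k a), and the frequency
    2^(k+1) c is 2 c in units of 2^k; hence the index 2 c - a + b. *)
Definition corr_shift k c : 'M[R]_m.+1 :=
  \matrix_(a, b) corr k (c * 2 - a%:Z + b%:Z) a b.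

Lemma corrS k c :
  corr k.+1 c = (2 ^+ m)^-1 *: (krawmx *m corr_shift k c *m krawmx^T).
Proof. by []. Qed.

Let w (a : 'I_m.+1) : R := ('C(m, a))%:R.

Let w_gt0 a : 0 < w a.
Proof. by rewrite /w ltr0n bin_gt0 -ltnS. Qed.

Lemma krawmx_sqr : krawmx *m krawmx = (2 ^+ m)%:M.
Proof.
apply/matrixP => i b; rewrite !mxE.
under eq_bigr do rewrite !mxE -rmorphM.
rewrite -rmorph_sum /= kraw_involutive -1?ltnS //.
by rewrite rmorphMn rmorphXn.
Qed.

Let W : 'M[R]_m.+1 := diag_mx (\row_a w a).

Lemma krawmx_sym : W *m krawmx = krawmx^T *m W.
Proof.
apply/matrixP => i a; rewrite mul_diag_mx mul_mx_diag !mxE /w.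
rewrite mulr_natl mulr_natr.
have := kraw_bin_sym (ltn_ord i : (i <= m)%N) (ltn_ord a : (a <= m)%N).
move=> /(congr1 (fun z : int => z%:~R : R)) /=.
by rewrite !rmorphMn.
Qed.

Let energy (Z : 'M[R]_m.+1) := \tr (W *m Z *m W *m Z^T).

Lemma energyE Z : energy Z = \sum_a \sum_b w a * w b * Z a b ^+ 2.
Proof.
rewrite /energy /mxtrace; apply: eq_bigr => a _.
rewrite mxE; apply: eq_bigr => b _.
by rewrite mul_mx_diag mul_diag_mx !mxE; ring.
Qed.

Lemma energyZ s Z : energy (s *: Z) = s ^+ 2 * energy Z.
Proof.
rewrite !energyE mulr_sumr; apply: eq_bigr => a _.
by rewrite mulr_sumr; apply: eq_bigr => b _; rewrite mxE; ring.
Qed.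

(** With K the Krawtchouk matrix, K^T W K = W K K = 2^m W, so K is a multiple of an isometry for the
    binomial weights. *)
Lemma energy_kraw y :
  energy (krawmx *m y *m krawmx^T) = 2 ^+ m * 2 ^+ m * energy y.
Proof.
have e0 : krawmx^T *m W *m krawmx = 2 ^+ m *: W.
  by rewrite -krawmx_sym -mulmxA krawmx_sqr mul_mx_scalar.
rewrite /energy !trmx_mul trmxK.
have -> : W *m (krawmx *m y *m krawmx^T) *m W *m (krawmx *m (y^T *m krawmx^T))
  = W *m krawmx *m y *m (krawmx^T *m W *m krawmx) *m y^T *m krawmx^T.
  by rewrite !mulmxA.
rewrite mxtrace_mulC.
have -> : krawmx^T *m (W *m krawmx *m y *m (krawmx^T *m W *m krawmx) *m y^T)
  = krawmx^T *m W *m krawmx *m y *m (krawmx^T *m W *m krawmx) *m y^T.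
  by rewrite !mulmxA.
rewrite e0 -!scalemxAl -scalemxAr -!scalemxAl !linearZ /=.
by rewrite -mulrA.
Qed.

(** If |c| > m then |2 c - a + b| >= 2 |c| - m > m, so the recursion reads only zeros. *)
Lemma corr_supp k (c : int) a b : (m < `|c|)%N -> corr k c a b = 0.
Proof.
elim: k c a b => [|k IH] c a b mc /=.
  by rewrite !mxE; case: eqP => [c0|_]; [rewrite c0 in mc | rewrite mulr0n mul0r].
rewrite -/(corr_shift k c).
have -> : corr_shift k c = 0.
  apply/matrixP => i j; rewrite !mxE IH //.
  by have := ltn_ord i; have := ltn_ord j; move: mc; lia.
by rewrite mulmx0 mul0mx scaler0 mxE.
Qed.

Let crange : seq int := [seq (j : nat)%:Z - m%:Z | j <- iota 0 (m + m).+1].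

Let mem_crange c : (c \in crange) = (`|c| <= m)%N.
Proof.
apply/mapP/idP => [[j]|cm].
  by rewrite mem_iota => jm ->; move: jm; lia.
exists `|(c + m%:Z)%R|%N; last by move: cm; lia.
by rewrite mem_iota; move: cm; lia.
Qed.

(** By [corr_supp] this is the total energy over all integers c. *)
Let V k := \sum_(c <- crange) energy (corr k c).

Let uniq_crange : uniq crange.
Proof. by rewrite map_inj_uniq ?iota_uniq // => i j; lia. Qed.

Let parity (c : int) (a b : 'I_m.+1) := odd (`|c| + a + b).

Let bad k c a b : R := w a * w b * corr k c a b ^+ 2 *+ parity c a b.

Let bad_ge0 k c a b : 0 <= bad k c a b.
Proof. by rewrite mulrn_wge0 // mulr_ge0 ?sqr_ge0 // ltW // mulr_gt0. Qed.

(* Since [krawmx] is orthogonal for the binomial weights, the energy of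
   [corr k.+1 c] is that of [corr_shift k c], and (c, a, b) |-> 2 c - a + b only
   reaches the entries with even [c + a + b]: the energy of the others is lost. *)
Lemma energy_decr k :
  V k.+1 + \sum_a \sum_b \sum_(c <- crange) bad k c a b <= V k.
Proof.
rewrite /V.
have eE k' : \sum_(c <- crange) energy (corr k' c) =
    \sum_a \sum_b \sum_(c <- crange) w a * w b * corr k' c a b ^+ 2.
  under eq_bigr do rewrite energyE.
  by rewrite exchange_big; apply: eq_bigr => a _; rewrite exchange_big.
have -> : \sum_(c <- crange) energy (corr k.+1 c) =
    \sum_(c <- crange) energy (corr_shift k c).
  apply: eq_bigr => c _; rewrite corrS.
  rewrite energyZ energy_kraw mulrA -expr2 -exprMn mulVf ?expr1n ?mul1r //.
have -> : \sum_(c <- crange) energy (corr_shift k c) =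
    \sum_a \sum_b \sum_(c <- crange)
      w a * w b * corr k (c * 2 - a%:Z + b%:Z) a b ^+ 2.
  under eq_bigr do rewrite energyE.
  rewrite exchange_big; apply: eq_bigr => a _; rewrite exchange_big.
  by apply: eq_bigr => b _; apply: eq_bigr => c _; rewrite mxE.
rewrite eE -big_split; apply: ler_sum => a _ /=.
rewrite -big_split; apply: ler_sum => b _ /=.
pose g c : R := w a * w b * corr k c a b ^+ 2 *+ ~~ parity c a b.
have -> : \sum_(c <- crange) w a * w b * corr k c a b ^+ 2 =
    \sum_(c <- crange) g c + \sum_(c <- crange) bad k c a b.
  rewrite -big_split; apply: eq_bigr => c _ /=; rewrite /g /bad.
  by case: parity; rewrite ?mulr0n ?mulr1n ?addr0 ?add0r.
rewrite lerD2r.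
have -> : \sum_(c <- crange) w a * w b * corr k (c * 2 - a%:Z + b%:Z) a b ^+ 2 =
    \sum_(c <- [seq c * 2 - a%:Z + b%:Z | c <- crange]) g c.
  rewrite [RHS]big_map; apply: eq_bigr => c _; rewrite /g.
  have -> : parity (c * 2 - a%:Z + b%:Z) a b = false by rewrite /parity; lia.
  by rewrite mulr1n.
apply: ler_sum_supp.
- by rewrite map_inj_uniq // => i j; lia.
- by move=> c; rewrite mulrn_wge0 // mulr_ge0 ?sqr_ge0 // ltW // mulr_gt0.
- move=> c _; rewrite mem_crange; apply: contraNT; rewrite -ltnNge => mc.
  by rewrite /g corr_supp // expr0n /= mulr0 mul0rn.
Qed.

(** The energy is nonincreasing and nonnegative, so its decrements tend to 0, and they dominate each
    lost entry. *)
Lemma corr_bad_null (c : int) (a b : 'I_m.+1) : odd (`|c| + a + b) ->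
  null (fun k => corr k c a b).
Proof.
move=> hc.
have V0 k : 0 <= V k.
  apply: sumr_ge0 => d _; rewrite energyE; apply: sumr_ge0 => i _.
  by apply: sumr_ge0 => j _; rewrite mulr_ge0 ?sqr_ge0 // ltW // mulr_gt0.
have badV k : bad k c a b <= V k - V k.+1.
  rewrite lerBrDl; apply: le_trans (energy_decr k).
  rewrite lerD2l (bigD1 a) //= (bigD1 b) //= -!addrA.
  have [cr|cr] := boolP (c \in crange).
    rewrite (big_rem c) //= -addrA lerDl !addr_ge0 //;
      try by repeat (apply: sumr_ge0 => ? _).
  have -> : bad k c a b = 0.
    rewrite /bad corr_supp ?expr0n ?mulr0 ?mul0rn //.
    by rewrite ltnNge -mem_crange.
  by rewrite !addr_ge0 //; repeat (apply: sumr_ge0 => ? _).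
have Vcvg : cvgn V.
  apply: nonincreasing_is_cvgn; last by exists 0 => _ [k _ <-].
  apply/nonincreasing_seqP => k; apply: le_trans (energy_decr k).
  by rewrite lerDl; repeat (apply: sumr_ge0 => ? _).
have dV : null (fun k => V k - V k.+1).
  rewrite /null -(subrr (limn V)); apply: cvgB => //.
  by rewrite (cvg_shiftS V).
have sq : null (fun k => (w a * w b) * corr k c a b ^+ 2).
  apply: null_squeeze dV => k; rewrite ger0_norm; last first.
    by rewrite mulr_ge0 ?sqr_ge0 // ltW // mulr_gt0.
  by apply: le_trans (badV k); rewrite /bad /parity hc mulr1n.
have {}sq : null (fun k => corr k c a b ^+ 2).
  have := nullZ (w a * w b)^-1 sq.
  by under eq_fun do rewrite mulKf ?gt_eqF ?mulr_gt0 //.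
apply/norm_cvg0P.
have -> : (fun k => `|corr k c a b|) = Num.sqrt \o (fun k => corr k c a b ^+ 2).
  by apply/funext => k /=; rewrite sqrtr_sqr.
by rewrite -sqrtr0; apply: continuous_cvg => //; exact: sqrt_continuous.
Qed.

End CorrelationArrays.


(** * Limits of the correlations *)

Section CorrelationLimits.
Variables (R : realType) (m : nat).

Local Notation krawmx := (krawmx R m).
Local Notation corr := (@corr R m).
Local Notation corr_shift := (@corr_shift R m).

Definition null_mx (Z : nat -> 'M[R]_m.+1) :=
  forall a b, null (fun k => Z k a b).

Lemma null_mx_mull (M : 'M[R]_m.+1) Z : null_mx Z -> null_mx (fun k => M *m Z k).
Proof.
move=> hZ a b; under eq_fun do rewrite mxE.
by apply: null_sum => j _; apply: nullZ.
Qed.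

Lemma null_mx_tr Z : null_mx Z -> null_mx (fun k => (Z k)^T).
Proof. by move=> hZ a b; under eq_fun do rewrite mxE; exact: hZ. Qed.

Lemma null_mx_conj (M : 'M[R]_m.+1) Z :
  null_mx Z -> null_mx (fun k => M *m Z k *m M^T).
Proof.
move=> hZ; have /null_mx_tr h1 := null_mx_mull M hZ.
have /null_mx_tr h2 := null_mx_mull M h1.
by under eq_fun do rewrite -[_ *m M^T]trmxK trmx_mul trmxK.
Qed.

Lemma null_mxZ s Z : null_mx Z -> null_mx (fun k => s *: Z k).
Proof. by move=> hZ a b; under eq_fun do rewrite mxE; apply: nullZ. Qed.

Let two_m_neq0 : (2 ^+ m : R) != 0.
Proof. by rewrite expf_neq0 // pnatr_eq0. Qed.

Lemma krawmx_revl (i a : 'I_m.+1) :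
  krawmx (rev_ord i) a = (-1) ^+ a * krawmx i a.
Proof.
rewrite !mxE /= subSS kraw_rev -1?ltnS //.
by rewrite rmorphM rmorphXn /= rmorphN1.
Qed.

Lemma krawmx_bin_sym (i a : 'I_m.+1) :
  ('C(m, i))%:R * krawmx i a = ('C(m, a))%:R * krawmx a i.
Proof.
have /matrixP/(_ i a) := krawmx_sym R m.
by rewrite mul_diag_mx mul_mx_diag !mxE => ->; rewrite mulrC.
Qed.

(** Up to the factor 2^m the Krawtchouk matrix is its own inverse, so the recursion can be solved
    for the older array. *)
Lemma corr_shiftE k c :
  corr_shift k c = (2 ^+ m)^-1 *: (krawmx *m corr k.+1 c *m krawmx^T).
Proof.
rewrite corrS -scalemxAr -scalemxAl !mulmxA krawmx_sqr.
have KT : krawmx^T *m krawmx^T = (2 ^+ m)%:M.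
  by rewrite -trmx_mul krawmx_sqr tr_scalar_mx.
rewrite -[_ *m krawmx^T *m krawmx^T]mulmxA KT.
rewrite mul_mx_scalar mul_scalar_mx !scalerA.
by rewrite mulrA mulfVK // mulVf // scale1r.
Qed.

(* By [corr_bad_null], conjugation by diag((-1)^i) acts asymptotically as (-1)^c
   on [corr k.+1 c]; the matrix [krawmx] turns it into the reversal of indices. *)
Lemma corr_shift_rev (c : int) (a b : 'I_m.+1) :
  null (fun k => corr_shift k c (rev_ord a) (rev_ord b)
                 - (-1) ^+ `|c|%N * corr_shift k c a b).
Proof.
have E k : corr_shift k c (rev_ord a) (rev_ord b) - (-1) ^+ `|c|%N * corr_shift k c a b
  = \sum_(i < m.+1) \sum_(j < m.+1) (2 ^+ m)^-1 * (((-1) ^+ (i + j) - (-1) ^+ `|c|%N)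
      * (krawmx a i * krawmx b j)) * corr k.+1 c i j.
  have entry (u v : 'I_m.+1) : corr_shift k c u v =
      \sum_i \sum_j (2 ^+ m)^-1 * (krawmx u i * krawmx v j) * corr k.+1 c i j.
    rewrite corr_shiftE mxE mxE exchange_big mulr_sumr; apply: eq_bigr => j _ /=.
    rewrite mxE mulr_suml mulr_sumr; apply: eq_bigr => i _.
    by rewrite [krawmx^T _ _]mxE; ring.
  rewrite !entry mulr_sumr -sumrB; apply: eq_bigr => i _.
  rewrite mulr_sumr -sumrB; apply: eq_bigr => j _.
  by rewrite !krawmx_revl exprD; ring.
under eq_fun do rewrite E.
apply: null_sum => i _; apply: null_sum => j _.
(* Terms with c + i + j odd tend to 0; in the others the sign factor is exactly 0. *)
have [odd_cij|even_cij] := boolP (odd (`|c| + i + j)).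
  by apply: nullZ; apply: (@null_shiftS R (fun k => corr k c i j)); exact: corr_bad_null.
have -> : (-1) ^+ (i + j) - (-1) ^+ `|c|%N = 0 :> R.
  rewrite -signr_odd -[X in _ - X]signr_odd.
  have -> : odd (i + j) = odd `|c|%N.
    by move: even_cij; rewrite -addnA oddD; case: odd; case: odd.
  by rewrite subrr.
by under eq_fun do rewrite mul0r mulr0 mul0r; exact: null0.
Qed.

Lemma null_corr_shift_rev (c : int) a b :
  null (fun k => corr_shift k c (rev_ord a) (rev_ord b)) ->
  null (fun k => corr_shift k c a b).
Proof.
move=> h.
have /(nullZ ((-1) ^+ `|c|%N)) := nullB h (corr_shift_rev c a b).
by under eq_fun do rewrite opprB addrC subrK mulrA -expr2 sqrr_sign mul1r.
Qed.

Lemma corr_null_of_shift (c : int) : null_mx (fun k => corr_shift k c) ->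
  null_mx (fun k => corr k c).
Proof.
move=> h a b; apply: null_ofS.
have := null_mxZ (2 ^+ m)^-1 (null_mx_conj krawmx h).
by move=> /(_ a b); under eq_fun do rewrite -corrS.
Qed.

(* One of 2 c - (a - b) and its mirror image 2 c + (a - b) is at least 2 |c| in
   absolute value. *)
Lemma corr_null_halve (B : nat) :
  (forall c : int, (B < `|c|)%N -> null_mx (fun k => corr k c)) ->
  forall c : int, (B < `|c| + `|c|)%N -> null_mx (fun k => corr k c).
Proof.
move=> SB c Bc; apply: corr_null_of_shift => a b.
have am := ltn_ord a; have bm := ltn_ord b.
have [h|h] := ltnP B `|c * 2 - a%:Z + b%:Z|.
  by under eq_fun do rewrite mxE; exact: SB.
apply: null_corr_shift_rev; under eq_fun do rewrite mxE; apply: SB.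
by rewrite /= !subSS; move: h Bc am bm; lia.
Qed.

(** The radius outside which the arrays tend to 0 is m at first, by [corr_supp], and is halved
    repeatedly down to 0. *)
Lemma corr_null (c : int) : c != 0 -> null_mx (fun k => corr k c).
Proof.
move=> c0.
suff S B : (forall d : int, (B < `|d|)%N -> null_mx (fun k => corr k d)) ->
    forall d : int, d != 0 -> null_mx (fun k => corr k d).
  apply: (S m) c0 => d md a b.
  by under eq_fun do rewrite corr_supp //; exact: null0.
elim/ltn_ind: B => -[|B] IH SB d d0.
  by apply: SB; move: d0; lia.
apply: (IH (B.+1)./2) d0; first by lia.
by move=> e Be; apply: (corr_null_halve SB); lia.
Qed.

(** If a + b is odd, the entry carries lost energy. If a - b = 2 c, it is the (a, b) entry of
    [corr_shift k c], whose mirror image has frequency index 4 c, which is nonzero. *)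
Lemma corr0_offdiag (a b : 'I_m.+1) : a != b -> null (fun k => corr k 0 a b).
Proof.
move=> ab; have am := ltn_ord a; have bm := ltn_ord b.
have [oab|eab] := boolP (odd (a + b)).
  by apply: corr_bad_null; rewrite absz0 add0n.
have [c cE] : exists c : int, c * 2 = a%:Z - b%:Z.
  by exists ((a%:Z - b%:Z) %/ 2)%Z; move: eab; lia.
have : null (fun k => corr_shift k c a b).
  apply: null_corr_shift_rev; under eq_fun do rewrite mxE.
  apply: corr_null; rewrite /= !subSS.
  have : (a != b :> nat) by rewrite (inj_eq val_inj).
  by move: am bm cE; lia.
under eq_fun do rewrite mxE.
by rewrite (_ : c * 2 - a%:Z + b%:Z = 0) //; move: cE; lia.
Qed.

Let w (a : 'I_m.+1) : R := ('C(m, a))%:R.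

Lemma krawmx_col0 i : krawmx i ord0 = 1.
Proof.
rewrite mxE /kraw -horner_coef0 !hornerE /=.
by rewrite ?subr0 ?addr0 ?expr1n ?mulr1.
Qed.

Lemma krawmx_row0 i : krawmx ord0 i = w i.
Proof.
have := krawmx_bin_sym ord0 i.
by rewrite /= bin0 mul1r krawmx_col0 mulr1.
Qed.

(** Column 0 of [corr k.+1 0 *m krawmx^T = krawmx *m corr_shift k 0]: in the limit only j = i
    survives on the left, where row 0 of the Krawtchouk matrix gives the weight, and only a = 0 on
    the right. *)
Lemma corr_diag_step (i : 'I_m.+1) :
  null (fun k => w i * corr k.+1 0 i i - corr k 0 ord0 ord0).
Proof.
have E k : \sum_j corr k.+1 0 i j * w j =
           \sum_a krawmx i a * corr_shift k 0 a ord0.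
  have : corr k.+1 0 *m krawmx^T = krawmx *m corr_shift k 0.
    rewrite corrS -scalemxAl -[_ *m krawmx^T *m krawmx^T]mulmxA.
    rewrite -trmx_mul krawmx_sqr tr_scalar_mx mul_mx_scalar scalerA.
    by rewrite mulVf // scale1r.
  move/matrixP/(_ i ord0); rewrite mxE [RHS]mxE => <-.
  by apply: eq_bigr => j _; rewrite [krawmx^T _ _]mxE krawmx_row0.
have E2 k : w i * corr k.+1 0 i i - corr k 0 ord0 ord0 =
    \sum_(a | a != ord0) krawmx i a * corr_shift k 0 a ord0
    - \sum_(j | j != i) w j * corr k.+1 0 i j.
  have := E k; rewrite (bigD1 i) //= [RHS](bigD1 ord0) //= krawmx_col0 mul1r.
  rewrite [X in X + _ = _ -> _]mulrC [corr_shift _ _ ord0 ord0]mxE.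
  rewrite (_ : 0 * 2 - 0%:Z + 0%:Z = 0 :> int) //.
  have -> : \sum_(j | j != i) corr k.+1 0 i j * w j =
     \sum_(j | j != i) w j * corr k.+1 0 i j.
    by apply: eq_bigr => j _; rewrite mulrC.
  by move=> h; apply/eqP; rewrite subr_eq addrAC eq_sym subr_eq addrC h addrC.
under eq_fun do rewrite E2.
apply: nullB; apply: null_sum => j ji; apply: nullZ.
  under eq_fun do rewrite mxE.
  by apply: corr_null; move: ji; rewrite -(inj_eq val_inj) /=; lia.
apply: (@null_shiftS R (fun k => corr k 0 i j)).
by apply: corr0_offdiag; rewrite eq_sym.
Qed.

(** This is the normalized mean of (|P|^2 + |Q|^2)^m = (2n)^m; in matrix terms, tr(W K Z K^T) = 2^m
    tr(W Z). *)
Lemma corr_trace k : \sum_a w a * corr k 0 a a = 1.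
Proof.
elim: k => [|k IH].
  have E0 (a : 'I_m.+1) : corr 0 0 a a = 2 ^- m by rewrite !mxE mulr1.
  under eq_bigr do rewrite E0.
  rewrite -mulr_suml -natr_sum.
  have -> : (\sum_(a < m.+1) 'C(m, a) = 2 ^ m)%N.
    by rewrite (expnDn 1 1); apply: eq_bigr => a _; rewrite !exp1n !muln1.
  by rewrite natrX mulfV.
have trE (Z : 'M[R]_m.+1) : \sum_a w a * Z a a = \tr (diag_mx (\row_a w a) *m Z).
  by apply: eq_bigr => a _; rewrite mul_diag_mx !mxE.
rewrite trE corrS -scalemxAr linearZ /=.
rewrite mulmxA mxtrace_mulC !mulmxA -krawmx_sym -[_ *m krawmx *m krawmx]mulmxA.
rewrite krawmx_sqr mul_mx_scalar -scalemxAl linearZ /= mulrA mulVf // mul1r.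
rewrite -trE -IH; apply: eq_bigr => a _; rewrite mxE.
by rewrite mul0r add0r addNr.
Qed.

(** In the limit the m + 1 terms of [corr_trace] all agree with the first entry and sum to 1; the
    limit is the m-th moment of the uniform law on [0, 1]. *)
Lemma corr0_lim_first : null (fun k => corr k 0 ord0 ord0 - m.+1%:R^-1).
Proof.
have m1 : m.+1%:R != 0 :> R by rewrite pnatr_eq0.
have : null (fun k => \sum_i (w i * corr k.+1 0 i i - corr k 0 ord0 ord0)).
  by apply: null_sum => i _; exact: corr_diag_step.
move=> /(nullZ (- m.+1%:R^-1)).
under eq_fun do rewrite sumrB corr_trace sumr_const card_ord mulNr mulrBr
  mulr1 opprB -[corr _ _ _ _ *+ _]mulr_natl mulKf //.
by [].
Qed.

Lemma corr0_lim_last : null (fun k => corr k 0 ord_max ord_max - m.+1%:R^-1).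
Proof.
apply: null_ofS; have := nullD (corr_diag_step ord_max) corr0_lim_first.
by under eq_fun do rewrite addrA subrK /w /= binn mul1r.
Qed.

End CorrelationLimits.


(** * Calculus of everywhere differentiable functions *)

Section GlobalDerivative.
Variable R : realType.
Implicit Types f g : R -> R.

Definition der f f' := forall t : R, is_derive t (1 : R) f (f' t).

Lemma der_eq f f' g' : (forall t, f' t = g' t) -> der f f' -> der f g'.
Proof. by move=> e h t; rewrite -e. Qed.

Lemma der_cst (c : R) : der (fun=> c) (fun=> 0).
Proof. by move=> t; exact: is_derive_cst. Qed.

Lemma derD f f' g g' : der f f' -> der g g' ->
  der (fun t => f t + g t) (fun t => f' t + g' t).
Proof. by move=> hf hg t; exact: is_deriveD. Qed.

Lemma derM f f' g g' : der f f' -> der g g' ->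
  der (fun t => f t * g t) (fun t => f' t * g t + f t * g' t).
Proof.
move=> hf hg t; apply: (is_derive_eq (is_deriveM (hf t) (hg t))).
by rewrite /GRing.scale /=; ring.
Qed.

Lemma derZ c f f' : der f f' -> der (fun t => c * f t) (fun t => c * f' t).
Proof.
by move=> hf; apply: der_eq (derM (der_cst c) hf) => t; rewrite mul0r add0r.
Qed.

Lemma derB f f' g g' : der f f' -> der g g' ->
  der (fun t => f t - g t) (fun t => f' t - g' t).
Proof. by move=> hf hg t; exact: is_deriveB. Qed.

Lemma der_sum (I : Type) (r : seq I) (P : pred I) (F F' : I -> R -> R) :
  (forall i, P i -> der (F i) (F' i)) ->
  der (fun t => \sum_(i <- r | P i) F i t) (fun t => \sum_(i <- r | P i) F' i t).
Proof.
move=> h; elim: r => [|i r IH].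
  under eq_fun do rewrite big_nil.
  by apply: der_eq (der_cst 0) => t; rewrite big_nil.
have [Pi|/negbTE Pi] := boolP (P i); under eq_fun do rewrite big_cons Pi.
  by apply: der_eq (derD (h i Pi) IH) => t; rewrite big_cons Pi.
by apply: der_eq IH => t; rewrite big_cons Pi.
Qed.

Lemma der_comp_scale c f f' : der f f' ->
  der (fun t => f (c * t)) (fun t => c * f' (c * t)).
Proof.
move=> hf t.
have hc : is_derive t (1 : R) (fun s : R => c * s) c.
  by have := derZ c (fun s => @is_derive_id _ _ s (1 : R)) t; rewrite mulr1.
by rewrite mulrC; exact: is_derive1_comp (hf (c * t)) hc.
Qed.

Lemma der_continuous f f' : der f f' -> continuous f.
Proof.
move=> hf t; apply: differentiable_continuous; apply/derivable1_diffP.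
by have [] := hf t.
Qed.

Lemma der_MVT f f' a b : der f f' -> a < b ->
  exists2 c, a < c < b & f b - f a = f' c * (b - a).
Proof.
move=> hf ab.
have [|c] := MVT ab (fun x _ => hf x).
  by apply: continuous_subspaceT; exact: der_continuous hf.
by rewrite in_itv /=; exists c.
Qed.

Lemma der_mono f f' a b : der f f' -> (forall x, a <= x <= b -> 0 <= f' x) ->
  a <= b -> f a <= f b.
Proof.
move=> hf f0; rewrite le_eqVlt => /predU1P[->//|ab].
have [c /andP[ac cb] e] := der_MVT hf ab.
by rewrite -subr_ge0 e mulr_ge0 ?f0 ?subr_ge0 ?ltW.
Qed.

End GlobalDerivative.

(** * Real parts and the exponential on the unit circle *)

Section ComplexExponential.
Variable R : realType.
Local Notation C := R[i].
Local Notation Re := (@complex.Re R).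
Local Notation Im := (@complex.Im R).
Implicit Types (z : C) (s t : R).

Lemma Re_add z z' : Re (z + z') = Re z + Re z'.
Proof. by case: z z' => [? ?] [? ?]. Qed.

Lemma Re_sum (I : Type) (r : seq I) (P : pred I) (F : I -> C) :
  Re (\sum_(i <- r | P i) F i) = \sum_(i <- r | P i) Re (F i).
Proof. by apply: (big_morph Re) => //; exact: Re_add. Qed.

Lemma Re_realM (a : R) z : Re (a%:C%C * z) = a * Re z.
Proof. by case: z => x y /=; rewrite mul0r subr0. Qed.

Lemma Re_intM (n : int) z : Re (n%:~R * z) = n%:~R * Re z.
Proof. by rewrite -Re_realM rmorph_int. Qed.

Lemma expiD s t : expi (s + t) = expi s * expi t :> C.
Proof. by rewrite /expi cosD sinD; apply/eqP; rewrite eq_complex /= eqxx addrC eqxx. Qed.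

Lemma expi0 : expi 0 = 1 :> C.
Proof. by rewrite /expi cos0 sin0. Qed.

Lemma conj_expi t : ((expi t)^*)%C = expi (- t).
Proof. by rewrite /expi cosN sinN. Qed.

Lemma expiX t n : expi t ^+ n = expi (n%:R * t) :> C.
Proof.
elim: n => [|n IH]; first by rewrite expr0 mul0r expi0.
by rewrite exprS IH -expiD -nat1r mulrDl mul1r.
Qed.

Lemma Re_mul_conj z : Re (z * z^*%C) = Re (`|z| ^+ 2).
Proof. by rewrite sqr_normc. Qed.

End ComplexExponential.

(** * Means of periodic functions *)

Section Means.
Variable R : realType.
Implicit Types F G : R -> R.

(* The mean of a 2 pi-periodic function, through a primitive instead of an
   integral. *)
Definition has_mean F a :=
  exists2 Psi, der Psi F & forall t, Psi (t + 2 * pi) = Psi t + 2 * pi * a.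

Lemma has_mean_cst (c : R) : has_mean (fun=> c) c.
Proof.
exists (fun t => c * t); last by move=> t; ring.
by apply: der_eq (derZ c (fun s => @is_derive_id _ _ s (1 : R))) => t; rewrite mulr1.
Qed.

Lemma has_meanD F G a b : has_mean F a -> has_mean G b ->
  has_mean (fun t => F t + G t) (a + b).
Proof.
move=> [f df pf] [g dg pg]; exists (fun t => f t + g t); first exact: derD.
by move=> t; rewrite pf pg; ring.
Qed.

Lemma has_meanZ c F a : has_mean F a -> has_mean (fun t => c * F t) (c * a).
Proof.
move=> [f df pf]; exists (fun t => c * f t); first exact: derZ.
by move=> t; rewrite pf; ring.
Qed.

Lemma has_mean_sum (I : Type) (r : seq I) (F : I -> R -> R) (a : I -> R) :
  (forall i, has_mean (F i) (a i)) ->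
  has_mean (fun t => \sum_(i <- r) F i t) (\sum_(i <- r) a i).
Proof.
move=> h; elim: r => [|i r IH].
  by under eq_fun do rewrite big_nil; rewrite big_nil; exact: has_mean_cst.
by under eq_fun do rewrite big_cons; rewrite big_cons; exact: has_meanD.
Qed.

Lemma has_mean_cos (c : int) :
  has_mean (fun t => cos (c%:~R * t)) ((c == 0)%:R).
Proof.
have [->|c0] := eqVneq c 0.
  by under eq_fun do rewrite mul0r cos0; exact: has_mean_cst.
have c0' : c%:~R != 0 :> R by rewrite intr_eq0.
exists (fun t => c%:~R^-1 * sin (c%:~R * t)).
  apply: der_eq (derZ _ (der_comp_scale c%:~R (@is_derive_sin R))) => t /=.
  by rewrite mulKf.
move=> t; rewrite mulr0 addr0; congr (_ * _).
have e (n : nat) u : sin (u + n%:R * (2 * pi)) = sin u :> R.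
  rewrite mulrC [2 * _]mulrC mulr_natr mulr_natr.
  by rewrite (periodicn (@sinD2pi R)).
have [n [->|->]] : exists n : nat, c = n%:Z \/ c = - n%:Z.
- by exists `|c|%N; lia.
- by rewrite mulrDr e.
- by rewrite -[in LHS](e n) rmorphN /=; congr sin; rewrite -[n%:~R]/(n%:R); ring.
Qed.

End Means.

(** * The correlation arrays as means over the circle *)

Section MomentIdentity.
Variables (R : realType) (m : nat).
Local Notation C := R[i].
Local Notation Re := (@complex.Re R).

Let P k t : C := (rudinP C k).[expi t].
Let Q k t : C := (rudinQ C k).[expi t].

Lemma rudinPS k t : P k.+1 t = P k t + expi ((2 ^+ k) * t) * Q k t.
Proof. by rewrite /P /Q /= !hornerE expiX natrX. Qed.

Lemma rudinQS k t : Q k.+1 t = P k t - expi ((2 ^+ k) * t) * Q k t.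
Proof. by rewrite /P /Q /= !hornerE expiX natrX. Qed.

Let form k t (a : nat) : C := P k t ^+ (m - a) * Q k t ^+ a.

(** Substituting the Rudin-Shapiro recursion into the forms of degree m is the Krawtchouk action,
    while the powers of z shift the frequency: exactly the recursion defining [corr]. *)
Lemma has_mean_corr k (c : int) (a b : 'I_m.+1) :
  has_mean (fun t => (2 ^+ (k.+1 * m))^-1 *
    Re (form k t a * ((form k t b)^*)%C * expi (- (2 ^+ k * c%:~R * t))))
    (corr R m k c a b).
Proof.
elim: k c a b => [|k IH] c a b.
  have form0 t i : form 0 t i = 1 by rewrite /form /P /Q /= !hornerE !expr1n mulr1.
  have E0 t : (2 ^+ (1 * m))^-1 * Re (form 0 t a * ((form 0 t b)^*)%C *
      expi (- (2 ^+ 0 * c%:~R * t))) = (2 ^+ m)^-1 * cos (c%:~R * t).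
    by rewrite !form0 conjc1 !mul1r /= cosN mul1n.
  under eq_fun do rewrite E0.
  have -> : corr R m 0 c a b = (2 ^+ m)^-1 * (c == 0)%:R.
    by rewrite !mxE mulr1 mulr_natr.
  apply: has_meanZ; exact: has_mean_cos.
have formS t i : (i <= m)%N -> form k.+1 t i = \sum_(a < m.+1)
    (kraw m i a)%:~R * (form k t a * expi (a%:R * (2 ^+ k * t))).
  move=> im; rewrite /form rudinPS rudinQS -kraw_homog //.
  by apply: eq_bigr => j _; rewrite exprMn expiX; ring.
have E t : (2 ^+ (k.+2 * m))^-1 * Re (form k.+1 t a * ((form k.+1 t b)^*)%C *
      expi (- (2 ^+ k.+1 * c%:~R * t))) =
   \sum_(i < m.+1) \sum_(j < m.+1) ((2 ^+ m)^-1 * krawmx R m a i * krawmx R m b j)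
     * ((2 ^+ (k.+1 * m))^-1 *
    Re (form k t i * ((form k t j)^*)%C
      * expi (- (2 ^+ k * (c * 2 - i%:Z + j%:Z)%:~R * t)))).
  rewrite (formS t a) -1?ltnS // (formS t b) -1?ltnS //.
  rewrite rmorph_sum /= mulr_suml mulr_suml Re_sum mulr_sumr.
  apply: eq_bigr => i _; rewrite mulr_sumr mulr_suml Re_sum mulr_sumr.
  apply: eq_bigr => j _.
  have cM (x y : C) : ((x * y)^*)%C = x^*%C * y^*%C by rewrite rmorphM.
  have cZ (n : int) : ((n%:~R : C)^*)%C = n%:~R by rewrite rmorph_int.
  move: (form k t i) (form k t j) => X Y; rewrite !cM cZ conj_expi.
  have -> : expi (- (2 ^+ k * (c * 2 - i%:Z + j%:Z)%:~R * t)) =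
      expi (i%:R * (2 ^+ k * t)) * expi (- (j%:R * (2 ^+ k * t)))
      * expi (- (2 ^+ k.+1 * c%:~R * t)) :> C.
    rewrite -!expiD !rmorphD rmorphN rmorphM /= exprS; congr expi.
    by rewrite -!pmulrn; ring.
  set e1 := expi _; set e2 := expi _; set e3 := expi _.
  have -> : (kraw m a i)%:~R * (X * e1) * ((kraw m b j)%:~R * (Y^*%C * e2)) * e3 =
     (kraw m a i)%:~R * ((kraw m b j)%:~R * (X * Y^*%C * (e1 * e2 * e3))) by ring.
  rewrite !Re_intM !mxE mulSn exprD invfM; ring.
under eq_fun do rewrite E.
have -> : corr R m k.+1 c a b = \sum_(i < m.+1) \sum_(j < m.+1)
   ((2 ^+ m)^-1 * krawmx R m a i * krawmx R m b j)
     * corr R m k (c * 2 - i%:Z + j%:Z) i j.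
  rewrite corrS mxE mxE exchange_big mulr_sumr; apply: eq_bigr => j _ /=.
  rewrite mxE mulr_suml mulr_sumr; apply: eq_bigr => i _.
  rewrite [(krawmx R m)^T _ _]mxE [corr_shift R m k c i j]mxE; ring.
apply: has_mean_sum => i; apply: has_mean_sum => j; apply: has_meanZ.
exact: IH.
Qed.

Lemma has_mean_moments k :
  has_mean (fun t => (sqmod_circle (rudinP C k) t / 2 ^+ k.+1) ^+ m)
    (corr R m k 0 ord0 ord0) /\
  has_mean (fun t => (sqmod_circle (rudinQ C k) t / 2 ^+ k.+1) ^+ m)
    (corr R m k 0 ord_max ord_max).
Proof.
have RX (z : C) : Re (z ^+ m * ((z ^+ m)^*)%C) = Re (`|z| ^+ 2) ^+ m.
  rewrite rmorphXn -exprMn -sqr_normc.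
  have -> : `|z| ^+ 2 = (Re (`|z| ^+ 2))%:C%C.
    by rewrite RRe_real // ger0_real // exprn_ge0.
  by rewrite -rmorphXn.
split.
  have := has_mean_corr k 0 ord0 ord0; congr has_mean.
  apply/funext => t; rewrite /form /= subn0 !expr0 !mulr1 mulr0 mul0r oppr0 expi0.
  by rewrite mulr1 RX expr_div_n -exprM mulrC.
have := has_mean_corr k 0 ord_max ord_max; congr has_mean.
apply/funext => t; rewrite /form /= subnn !expr0 !mul1r mulr0 mul0r oppr0 expi0.
by rewrite mulr1 RX expr_div_n -exprM mulrC.
Qed.

End MomentIdentity.


(** * Bernstein-type bounds for the Rudin-Shapiro polynomials *)

Section DerivativeBounds.
Variables (F : numClosedFieldType) (s : F).
Hypotheses (s_ge0 : 0 <= s) (s2 : s ^+ 2 = 2).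
Implicit Types (p q : {poly F}) (z al be rho : F).

(* The [m]-th power of the operator X d/dX. *)
Definition theta m p : {poly F} := \poly_(j < size p) (p`_j * j%:R ^+ m).

Lemma coef_theta m p j : (theta m p)`_j = p`_j * j%:R ^+ m.
Proof. by rewrite coef_poly; case: ltnP => // sj; rewrite nth_default ?mul0r. Qed.

Lemma thetaD m p q : theta m (p + q) = theta m p + theta m q.
Proof. by apply/polyP => j; rewrite !(coef_theta, coefD) mulrDl. Qed.

Lemma thetaB m p q : theta m (p - q) = theta m p - theta m q.
Proof. by apply/polyP => j; rewrite !(coef_theta, coefB) mulrBl. Qed.

Lemma theta1 m : theta m 1 = (m == 0)%:R%:P.
Proof.
apply/polyP => j; rewrite coef_theta coef1 coefC.
by case: eqP => [->|_]; rewrite ?mul0r // mul1r expr0n.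
Qed.

(** Leibniz rule: the factor (N + i)^m on the coefficient of index N + i is expanded binomially. *)
Lemma thetaXnM m N q : theta m ('X^N * q) =
  'X^N * \sum_(j < m.+1) ((N ^ (m - j) * 'C(m, j))%:R *: theta j q).
Proof.
apply/polyP => i; rewrite coef_theta !coefXnM; case: ltnP => [_|Ni].
  by rewrite mul0r.
rewrite coef_sum -[in X in _ * X](subnKC Ni) natrD exprDn mulr_sumr.
apply: eq_bigr => j _; rewrite coefZ coef_theta natrM natrX -mulr_natr; ring.
Qed.

Lemma parallelogram al be :
  `|al + be| ^+ 2 + `|al - be| ^+ 2 = 2 * (`|al| ^+ 2 + `|be| ^+ 2).
Proof. by rewrite !normCK rmorphD rmorphB /=; ring. Qed.

Lemma ler_of_sqr (x y : F) : 0 <= x -> 0 <= y -> x ^+ 2 <= y ^+ 2 -> x <= y.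
Proof. by move=> x0 y0; rewrite ler_pXn2r. Qed.

(* Bounding the whole pencil of combinations makes the induction close: the
   recursion sends (al, be) to (al + be, z^N (al - be)), which scales the
   Euclidean norm by sqrt 2. *)
Lemma theta_rudin_bound k m al be rho z : `|z| = 1 -> 0 <= rho ->
  `|al| ^+ 2 + `|be| ^+ 2 <= rho ^+ 2 ->
  `|al * (theta m (rudinP F k)).[z] + be * (theta m (rudinQ F k)).[z]|
    <= rho * s ^+ k.+1 * (2 ^+ k) ^+ m.
Proof.
move=> z1; elim: k m al be rho => [|k IH] m al be rho rho0 ab.
  rewrite /= !theta1 !hornerC expr1 expr0 expr1n mulr1.
  case: m => [|m]; last by rewrite /= !mulr0 addr0 normr0 mulr_ge0.
  rewrite /= !mulr1; apply: ler_of_sqr; rewrite ?mulr_ge0 //.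
  rewrite exprMn s2 mulrC.
  apply: (@le_trans _ _ (`|al + be| ^+ 2 + `|al - be| ^+ 2)).
    by rewrite lerDl exprn_ge0.
  by rewrite parallelogram ler_wpM2l.
pose N : F := 2 ^+ k; pose A := rho * s * s ^+ k.+1.
have N0 : 0 <= N by rewrite exprn_ge0.
have ab2 : `|al + be| ^+ 2 + `|al - be| ^+ 2 <= (rho * s) ^+ 2.
  by rewrite parallelogram exprMn s2 mulrC ler_wpM2r.
have rs0 : 0 <= rho * s by rewrite mulr_ge0.
have amb : `|al - be| <= rho * s.
  apply: ler_of_sqr => //; apply: le_trans ab2.
  by rewrite lerDr exprn_ge0.
have Qj j : `|(theta j (rudinQ F k)).[z]| <= s ^+ k.+1 * N ^+ j.
  have := IH j 0 1 1 ler01; rewrite mul0r add0r mul1r normr0 normr1 mul1r.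
  by apply; rewrite expr0n add0r.
(* [last] collects the terms where all m derivatives fall on the polynomials of level k, [low] those
   where at least one falls on z^N. *)
pose last := (al + be) * (theta m (rudinP F k)).[z]
  + (al - be) * z ^+ (2 ^ k) * (theta m (rudinQ F k)).[z].
pose low := \sum_(j < m) (al - be) * z ^+ (2 ^ k) *
  ((2 ^ k) ^ (m - j) * 'C(m, j))%:R * (theta j (rudinQ F k)).[z].
have -> : al * (theta m (rudinP F k.+1)).[z] + be * (theta m (rudinQ F k.+1)).[z]
   = last + low.
  rewrite /= thetaD thetaB thetaXnM !hornerE horner_sum.
  rewrite big_ord_recr /= subnn expn0 mul1n binn hornerZ mul1r.
  rewrite /last; have -> : low = (al - be) * z ^+ (2 ^ k) * \sum_(j < m)
      (((2 ^ k) ^ (m - j) * 'C(m, j))%:R *: theta j (rudinQ F k)).[z].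
    rewrite mulr_sumr; apply: eq_bigr => j _; rewrite hornerZ; ring.
  ring.
have last_le : `|last| <= A * N ^+ m.
  apply: IH => //; rewrite normrM normrX z1 expr1n mulr1 //.
have low_le : `|low| <= \sum_(j < m) A * N ^+ m *+ 'C(m, j).
  apply: le_trans (ler_norm_sum _ _ _) _; apply: ler_sum => j _.
  rewrite !normrM normrX z1 expr1n mulr1 normr_nat natrM natrX natrX -/N.
  have -> : A * N ^+ m *+ 'C(m, j) = rho * s * (N ^+ (m - j) * 'C(m, j)%:R)
     * (s ^+ k.+1 * N ^+ j).
    rewrite -mulr_natr -{1}(subnK (ltnW (ltn_ord j))) exprD /A; ring.
  rewrite ler_pM ?normr_ge0 ?mulr_ge0 ?normr_ge0 ?exprn_ge0 //.
  by rewrite ler_wpM2r ?mulr_ge0 ?exprn_ge0.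
apply: le_trans (ler_normD _ _) _; apply: le_trans (lerD last_le low_le) _.
(* The multiple 1 of A N^m from [last] and the binomials with j < m from [low] add up to 2^m, which
   turns N^m into (2 N)^m. *)
have bin_sum : (\sum_(i < m) 'C(m, i) + 1 = 2 ^ m)%N.
  rewrite (expnDn 1 1) big_ord_recr /= binn !exp1n !muln1; congr (_ + 1)%N.
  by apply: eq_bigr => a _; rewrite !exp1n !muln1.
rewrite addrC sumrMnr -mulrSr -addn1 bin_sum.
rewrite -[X in X <= _]mulr_natr natrX /A [s ^+ k.+2]exprS [(2 : F) ^+ k.+1]exprS exprMn.
by rewrite le_eqVlt; apply/orP; left; apply/eqP; rewrite /N; ring.
Qed.

End DerivativeBounds.


(** * Derivatives of the squared modulus on the circle *)

Section DerivativeChain.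
Variable R : realType.
Local Notation C := R[i].
Local Notation Re := (@complex.Re R).
Local Notation Im := (@complex.Im R).

Lemma der_Re_horner (c : C) (p : {poly C}) :
  der (fun t => Re (c * p.[expi t]))
      (fun t => Re (c * 'i%C * (theta 1 p).[expi t])).
Proof.
have term (z : C) (j : nat) : der (fun t => Re (z * expi t ^+ j))
    (fun t => Re (z * (j%:R * 'i%C) * expi t ^+ j)).
  have E (z' : C) t : Re (z' * expi t ^+ j) =
      Re z' * cos (j%:R * t) - Im z' * sin (j%:R * t).
    by rewrite expiX; case: z'.
  under eq_fun do rewrite E.
  apply: der_eq (derB (derZ (Re z) (der_comp_scale j%:R (@is_derive_cos R)))
    (derZ (Im z) (der_comp_scale j%:R (@is_derive_sin R)))) => t /=.
  have -> : z * (j%:R * 'i%C) = (j%:R : R)%:C%C * (z * 'i%C).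
    by rewrite mulrCA rmorph_nat.
  rewrite -mulrA Re_realM E; case: z => x y /=.
  by rewrite !(mulr0, mulr1, mul0r, sub0r, add0r, addr0); ring.
have E t : Re (c * p.[expi t]) =
    \sum_(j < size p) Re (c * p`_j * expi t ^+ j).
  by rewrite horner_coef mulr_sumr Re_sum; apply: eq_bigr => j _; rewrite mulrA.
under eq_fun do rewrite E.
have := @der_sum R 'I_(size p) (index_enum _) xpredT _ _
  (fun j _ => term (c * p`_j) j).
apply: der_eq => t.
rewrite (@horner_coef_wide _ (size p)) ?size_poly // mulr_sumr Re_sum.
by apply: eq_bigr => j _; rewrite coef_theta expr1; congr Re; ring.
Qed.

Lemma Im_Re (z : C) : Im z = Re (- 'i%C * z).
Proof. by case: z => x y /=; rewrite !(oppr0, mul0r, sub0r, mulN1r, opprK). Qed.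

(* [circ_deriv p j] is the [j]-th derivative of [fun t => p.[expi t]]. *)
Definition circ_deriv (p : {poly C}) (j : nat) (t : R) : C :=
  'i%C ^+ j * (theta j p).[expi t].

Lemma theta_theta1 m (p : {poly C}) : theta 1 (theta m p) = theta m.+1 p.
Proof. by apply/polyP => j; rewrite !coef_theta expr1 exprSr mulrA. Qed.

Lemma der_circ_deriv p j :
  der (fun t => Re (circ_deriv p j t)) (fun t => Re (circ_deriv p j.+1 t)) /\
  der (fun t => Im (circ_deriv p j t)) (fun t => Im (circ_deriv p j.+1 t)).
Proof.
split.
  apply: der_eq (der_Re_horner ('i%C ^+ j) (theta j p)) => t.
  by rewrite /circ_deriv theta_theta1 exprSr.
under eq_fun do rewrite Im_Re /circ_deriv mulrA.
apply: der_eq (der_Re_horner (- 'i%C * 'i%C ^+ j) (theta j p)) => t.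
by rewrite Im_Re /circ_deriv theta_theta1 exprSr !mulrA.
Qed.

(* Derivative of order [m] of Re (f^(i) conj(f^(j))), for f = p.[expi t]. *)
Fixpoint cross_deriv (p : {poly C}) (m i j : nat) (t : R) : R :=
  if m is m'.+1 then cross_deriv p m' i.+1 j t + cross_deriv p m' i j.+1 t
  else Re (circ_deriv p i t * (circ_deriv p j t)^*%C).

Lemma der_cross_deriv p m i j :
  der (cross_deriv p m i j) (cross_deriv p m.+1 i j).
Proof.
elim: m i j => [|m IH] i j; last exact: derD (IH _ _) (IH _ _).
have E i' j' t : Re (circ_deriv p i' t * (circ_deriv p j' t)^*%C) =
    Re (circ_deriv p i' t) * Re (circ_deriv p j' t)
    + Im (circ_deriv p i' t) * Im (circ_deriv p j' t).
  by case: circ_deriv => ? ?; case: circ_deriv => ? ? /=; rewrite mulrN opprK.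
have [ri ii] := der_circ_deriv p i; have [rj ij] := der_circ_deriv p j.
rewrite /=; under eq_fun do rewrite E.
by apply: der_eq (derD (derM ri rj) (derM ii ij)) => t; rewrite !E; ring.
Qed.

Lemma norm_Re_le (z : C) (a : R) : `|z| <= a%:C%C -> `|Re z| <= a.
Proof. by move=> h; rewrite -lecR; apply: le_trans (normc_ge_Re z) h. Qed.

Lemma norm_circ_deriv p j t : `|circ_deriv p j t| = `|(theta j p).[expi t]|.
Proof.
have i1 : `|'i%C| = 1 :> C by rewrite normc_def /= expr0n expr1n add0r sqrtr1.
by rewrite normrM normrX i1 expr1n mul1r.
Qed.

Variables (p : {poly C}) (A B : R).
Hypothesis p_le : forall j t, `|(theta j p).[expi t]| <= (A * B ^+ j)%:C%C.

(** There are 2^m Leibniz terms, each a product of two derivatives whose orders add up to i + j +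
    m. *)
Lemma cross_deriv_le m i j t :
  `|cross_deriv p m i j t| <= A ^+ 2 * B ^+ (i + j) * (2 * B) ^+ m.
Proof.
elim: m i j => [|m IH] i j /=.
  apply: norm_Re_le; rewrite normrM normcJ !norm_circ_deriv.
  have -> : A ^+ 2 * B ^+ (i + j) * (2 * B) ^+ 0 = (A * B ^+ i) * (A * B ^+ j).
    by rewrite exprD; ring.
  by rewrite rmorphM ler_pM.
apply: le_trans (ler_normD _ _) _; apply: le_trans (lerD (IH _ _) (IH _ _)) _.
by rewrite addSn addnS !exprS; lra.
Qed.

(** The derivative of |f|^2 is 2 Re(f' conj f), at most 2 A B |f|; hence |f|^2 is flat where it is
    small. *)
Lemma cross_deriv1_sqr_le t :
  cross_deriv p 1 0 0 t ^+ 2 <= 4 * (A * B) ^+ 2 * cross_deriv p 0 0 0 t.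
Proof.
pose f := circ_deriv p 0 t; pose f' := circ_deriv p 1 t.
have -> : cross_deriv p 1 0 0 t = 2 * Re (f' * f^*%C).
  rewrite /= -/f -/f'.
  have -> : Re (f * f'^*%C) = Re (f' * f^*%C).
    by case: f f' => ? ? [? ?] /=; ring.
  by ring.
have f'_le : `|f'| <= (A * B)%:C%C by rewrite norm_circ_deriv -[B]expr1.
have -> : cross_deriv p 0 0 0 t = Re (`|f| ^+ 2) by rewrite /= Re_mul_conj.
have normE (z : C) : `|z| = (Re `|z|)%:C%C by rewrite RRe_real ?normr_real.
have Re_norm_ge0 (z : C) : 0 <= Re `|z| by rewrite -lecR -normE; exact: normr_ge0.
have -> : Re (`|f| ^+ 2) = Re `|f| ^+ 2 by rewrite {1}normE -rmorphXn.
have r_le : `|Re (f' * f^*%C)| <= Re `|f'| * Re `|f|.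
  by apply: norm_Re_le; rewrite normrM normcJ {1}normE {1}[`|f|]normE rmorphM.
have r'_le : Re `|f'| <= A * B by rewrite -lecR -normE.
set X := Re (f' * _) in r_le *; set r := Re `|f| in r_le *.
have -> : (2 * X) ^+ 2 = 4 * `|X| ^+ 2 by rewrite real_normK ?num_real //; ring.
have -> : 4 * (A * B) ^+ 2 * r ^+ 2 = 4 * (A * B * r) ^+ 2 by ring.
have AB0 : 0 <= A * B := le_trans (Re_norm_ge0 f') r'_le.
have r0 : 0 <= r := Re_norm_ge0 f.
rewrite ler_wpM2l // ler_pXn2r ?nnegrE ?(mulr_ge0 AB0 r0) //.
by apply: le_trans r_le _; rewrite ler_wpM2r ?Re_norm_ge0.
Qed.

End DerivativeChain.

(** * The derivative chain of the Rudin-Shapiro squared moduli *)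

Section RudinChain.
Variables (R : realType).
Local Notation C := R[i].

Lemma norm_expi (t : R) : `|expi t| = 1 :> C.
Proof. by rewrite normc_def /= cos2Dsin2 sqrtr1. Qed.

Lemma sqmod_rudin_add k (t : R) :
  sqmod_circle (rudinP C k) t + sqmod_circle (rudinQ C k) t = 2 ^+ k.+1.
Proof.
have h : `|(rudinP C k).[expi t]| ^+ 2 + `|(rudinQ C k).[expi t]| ^+ 2 = 2 ^+ k.+1.
  elim: k => [|k IH]; first by rewrite /= !hornerE normr1 expr1n.
  rewrite /= !hornerE parallelogram normrM normrX norm_expi expr1n mul1r.
  by rewrite IH [RHS]exprS.
rewrite /sqmod_circle -Re_add h.
by rewrite -(rmorph_nat (real_complex R)) -rmorphXn.
Qed.

Lemma sqmod_circle_ge0 (p : {poly C}) t : 0 <= sqmod_circle p t.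
Proof.
have : (0 : C) <= `|p.[expi t]| ^+ 2 by rewrite exprn_ge0.
by rewrite lecE => /andP[].
Qed.

Definition deriv_chain (F : nat -> R -> R) := forall m, der (F m) (F m.+1).

(** The general bounds are used with A^2 = 2n and B = n, so that 4 (A B)^2 = 8 n^3. *)
Lemma rudin_chain k (p : {poly C}) : p = rudinP C k \/ p = rudinQ C k ->
  exists F : nat -> R -> R, [/\ deriv_chain F, F 0%N = sqmod_circle p,
    forall m t, `|F m t| <= 2 ^+ k.+1 * (2 ^+ k.+1) ^+ m
    & forall t, F 1%N t ^+ 2 <= 8 * (2 ^+ k) ^+ 3 * F 0%N t].
Proof.
move=> pE; exists (fun m => cross_deriv p m 0 0).
pose s : R := Num.sqrt 2.
have s0 : 0 <= s by rewrite sqrtr_ge0.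
have s2 : s ^+ 2 = 2 by rewrite sqr_sqrtr.
have s2X j : (s ^+ j) ^+ 2 = 2 ^+ j by rewrite -exprM mulnC exprM s2.
have le j t : `|(theta j p).[expi t]| <= (s ^+ k.+1 * (2 ^+ k) ^+ j)%:C%C.
  have s0C : 0 <= s%:C%C by rewrite lecR.
  have s2C : s%:C%C ^+ 2 = 2 by rewrite -rmorphXn s2 rmorph_nat.
  have := @theta_rudin_bound _ _ s0C s2C k j _ _ _ _ (norm_expi t) ler01.
  rewrite rmorphM !rmorphXn rmorph_nat.
  case: pE => -> h; [move: (h 1 0)|move: (h 0 1)];
  by rewrite !(mul0r, mul1r, add0r, addr0) normr0 normr1 expr0n expr1n
    !(add0r, addr0); apply.
split.
- by move=> m; exact: der_cross_deriv.
- by apply/funext => t; rewrite /= /circ_deriv expr0 mul1r Re_mul_conj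
    (_ : theta 0 p = p) //; apply/polyP => j; rewrite coef_theta expr0 mulr1.
- move=> m t. apply: le_trans (cross_deriv_le le m 0 0 t) _.
  by rewrite s2X expr0 mulr1 -exprS.
- move=> t; apply: le_trans (cross_deriv1_sqr_le le t) _.
  rewrite exprMn s2X exprS; set F0 := cross_deriv _ _ _ _ _.
  by rewrite le_eqVlt; apply/orP; left; apply/eqP; ring.
Qed.

End RudinChain.


(** * Size of a function near a cluster of its zeros *)

Section HermiteBound.
Variable R : realType.
Implicit Types (F : nat -> R -> R) (z : nat -> R).

(* The [z i] with [i < N] are zeros of [F 0], a value repeated [j] times being a
   zero of multiplicity at least [j]; [F j] is the [j]-th derivative. *)
Definition has_zeros F z N :=
  (forall i, (i.+1 < N)%N -> z i <= z i.+1) /\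
  (forall i j, (i + j < N)%N -> z i = z (i + j)%N -> F j (z i) = 0).

Lemma has_zeros_mono F z N : has_zeros F z N ->
  forall i j, (i <= j)%N -> (j < N)%N -> z i <= z j.
Proof.
move=> [zS _] i j; elim: j => [|j IH]; first by rewrite leqn0 => /eqP->.
rewrite leq_eqVlt => /predU1P[->//|]; rewrite ltnS => ij jN.
by apply: le_trans (IH ij (ltnW jN)) _; exact: zS.
Qed.

Lemma has_zeros_sub F z N i m : has_zeros F z N -> (i + m <= N)%N ->
  has_zeros F (fun l => z (i + l)%N) m.
Proof.
move=> [zS z0] imN; split=> [l lm|l j ljm].
  by rewrite addnS; apply: zS; apply: leq_trans imN; rewrite -addnS ltn_add2l.
by rewrite addnA; apply: z0; apply: leq_trans imN; rewrite -addnA ltn_add2l.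
Qed.

(** Rolle gives a new zero between distinct neighbours, and a repeated zero is kept with its
    multiplicity lowered by one. *)
Lemma has_zeros_rolle F z m : deriv_chain F -> has_zeros F z m.+1 ->
  exists2 z', (forall i, (i < m)%N -> z i <= z' i <= z i.+1) &
    has_zeros (fun j => F j.+1) z' m.
Proof.
move=> dF hz; have [zS z0] := hz.
have /choice[z' hz'] : forall i, exists y, (i < m)%N ->
    [/\ F 1%N y = 0, z i = z i.+1 -> y = z i &
        z i < z i.+1 -> z i < y < z i.+1].
  move=> i; have [im|] := ltnP i m; last by exists 0.
  have := zS i im; rewrite le_eqVlt => /predU1P[e|lt].
    exists (z i) => _; split=> //; last by rewrite e ltxx.
    by apply: z0; rewrite addn1.
  have [c cz Fc] := der_MVT (dF 0%N) lt.
  exists c => _; split=> //; last by move=> e; move: lt; rewrite e ltxx.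
  have Fz l : (l < m.+1)%N -> F 0%N (z l) = 0.
    by move=> lm; apply: z0; rewrite addn0.
  move: Fc; rewrite !Fz // ?ltnS 1?ltnW // subrr => /esym/eqP.
  by rewrite mulf_eq0 subr_eq0 (gt_eqF lt) orbF => /eqP.
have bnd i : (i < m)%N -> z i <= z' i <= z i.+1.
  move=> im; have [_ eq_z lt_z] := hz' i im.
  have := zS i im; rewrite le_eqVlt => /predU1P[e|lt].
    by rewrite -e eq_z // lexx.
  by have /andP[l r] := lt_z lt; rewrite !ltW.
exists z' => //; split=> [i im|i [|j] ijm e].
- have /andP[_ h1] := bnd i (ltnW im); have /andP[h2 _] := bnd _ im.
  exact: le_trans h2.
- by have [] := hz' i; first by rewrite addn0 in ijm.
(* Interlacing squeezes z (i+1) and z (i+j+1) to the common value of the z'; strict interlacing then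
   excludes z i and z (i+j+2) being different from it, so z has j + 3 equal entries. *)
have im : (i < m)%N by apply: leq_ltn_trans ijm; rewrite leq_addr.
have mono a b : (a <= b)%N -> (b < m.+1)%N -> z a <= z b by exact: has_zeros_mono hz a b.
have /andP[li ri] := bnd i im; have /andP[lj rj] := bnd _ ijm.
have ij : z i.+1 <= z (i + j.+1)%N by apply: mono; lia.
have zi1 : z' i = z i.+1.
  by apply/eqP; rewrite eq_le ri /= (le_trans ij) // (le_trans lj) // e.
have zij : z' i = z (i + j.+1)%N.
  by apply/eqP; rewrite eq_le {1}zi1 ij e lj.
have [_ eq_z lt_z] := hz' i im.
have zi : z i = z i.+1.
  apply/eqP; rewrite eq_le zS //= leNgt; apply/negP => /lt_z/andP[_].
  by rewrite zi1 ltxx.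
have [_ eq_zj lt_zj] := hz' _ ijm.
have zj : z (i + j.+1)%N = z (i + j.+1).+1.
  apply/eqP; rewrite eq_le zS //= leNgt; apply/negP => /lt_zj/andP[].
  by rewrite -e zij ltxx.
rewrite zi1 -zi; apply: z0; first by rewrite addnS.
by rewrite addnS -zj -zij zi1.
Qed.

Lemma der_shift_pow (c : R) n :
  der (fun y => (y - c) ^+ n.+1) (fun y => n.+1%:R * (y - c) ^+ n).
Proof.
have d1 : der (fun y => y - c) (fun=> 1).
  apply: der_eq (derB (fun s => @is_derive_id _ _ s (1 : R)) (der_cst c)) => t.
  by rewrite subr0.
elim: n => [|n IH].
  by under eq_fun do rewrite expr1; apply: der_eq d1 => t; rewrite expr0 mulr1.
under eq_fun do rewrite exprS.
by apply: der_eq (derM d1 IH) => t; rewrite -[n.+2]add1n natrD exprS; ring.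
Qed.

(** Induction on m: Rolle and the hypothesis for the derivative give |F 1| <= g' beyond the last
    zero z m, where F 0 vanishes and g >= 0; then g - F 0 and g + F 0 are nondecreasing there. *)
Lemma hermite_bound F z m (M : R) x : deriv_chain F -> has_zeros F z m ->
  (forall t, `|F m t| <= M) -> (forall i, (i < m)%N -> z i <= x) ->
  `|F 0%N x| <= M * (x - z 0%N) ^+ m / m`!%:R.
Proof.
elim: m F z x => [|m IH] F z x dF hz FM zx.
  by rewrite expr0 mulr1 fact0 divr1.
have M0 : 0 <= M by apply: le_trans (FM 0); rewrite normr_ge0.
have [z' zz' hz'] := has_zeros_rolle dF hz.
have mono a b : (a <= b)%N -> (b < m.+1)%N -> z a <= z b by exact: has_zeros_mono hz a b.
pose g y := M / m.+1`!%:R * (y - z 0%N) ^+ m.+1.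
pose g' y := M / m`!%:R * (y - z 0%N) ^+ m.
have dg : der g g'.
  apply: der_eq (derZ _ (der_shift_pow (z 0%N) m)) => t.
  have m0 : m.+1%:R != 0 :> R by rewrite pnatr_eq0.
  have mf0 : m`!%:R != 0 :> R by rewrite pnatr_eq0 -lt0n fact_gt0.
  rewrite /g' factS natrM; move: m.+1%:R m`!%:R m0 mf0 => a b a0 b0.
  by field; rewrite a0 b0.
have F1 y : z m <= y <= x -> `|F 1%N y| <= g' y.
  move=> /andP[zy _].
  have dF' : deriv_chain (fun j => F j.+1) by move=> j; exact: dF.
  have z'y i : (i < m)%N -> z' i <= y.
    move=> im; have /andP[_ h] := zz' i im; apply: le_trans h _.
    by apply: le_trans zy; exact: mono.
  apply: le_trans (IH _ _ y dF' hz' FM z'y) _.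
  rewrite /g' [leRHS]mulrAC; rewrite ler_wpM2r ?invr_ge0 ?ler0n // ler_wpM2l //.
  case: (m) zz' z'y => [//|m'] zz' z'y.
  have /andP[h _] := zz' 0%N isT.
  by rewrite lerXn2r ?nnegrE ?subr_ge0 ?lerB ?(le_trans h) ?z'y.
have Fz : F 0%N (z m) = 0 by case: hz => _; apply; rewrite ?addn0.
have gz : 0 <= g (z m).
  by rewrite /g !mulr_ge0 ?invr_ge0 ?exprn_ge0 ?subr_ge0 ?mono.
have zmx : z m <= x by exact: zx.
rewrite mulrAC -/(g x) ler_norml; apply/andP; split.
- rewrite lerNl -subr_ge0 opprK addrC; apply: (@le_trans _ _ (F 0%N (z m) + g (z m))).
    by rewrite Fz add0r.
  apply: der_mono (derD (dF 0%N) dg) _ zmx => y yx.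
  by have := F1 y yx; rewrite ler_norml => /andP[]; lra.
- rewrite -subr_ge0; apply: (@le_trans _ _ (g (z m) - F 0%N (z m))).
    by rewrite Fz subr0.
  apply: der_mono (derB dg (dF 0%N)) _ zmx => y yx.
  by have := F1 y yx; rewrite ler_norml => /andP[]; lra.
Qed.

(** m^m <= 2m (2m - 1) ... (m + 1) = C(2m, m) m!, and C(2m, m) <= 4^m. *)
Lemma expnn_le_fact m : (m ^ m <= 4 ^ m * m`!)%N.
Proof.
apply: (@leq_trans ((m + m) ^_ m)).
  rewrite ffact_prod -[X in (X <= _)%N](_ : (\prod_(i < m) m)%N = _).
    by apply: leq_prod => i _; rewrite -addnBA ?leq_addr // ltnW.
  by rewrite prod_nat_const card_ord.
rewrite -bin_ffact leq_mul2r; apply/orP; right.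
have -> : (4 ^ m = (1 + 1) ^ (m + m))%N by rewrite expnD -expnMn.
rewrite expnDn (bigD1 (inord m)) //= !exp1n !muln1 inordK ?leq_addr // ltnS leq_addr.
Qed.

(* As m^m <= 4^m m!, the Hermite remainder of a cluster of [m] zeros spread over
   a window of length [m * w] decays geometrically in [m]. *)
Lemma cluster_bound F z m (A B w x : R) : deriv_chain F -> has_zeros F z m ->
  0 <= A -> 0 <= B -> (forall t, `|F m t| <= A * B ^+ m) ->
  (forall i, (i < m)%N -> z i <= x) -> 0 <= x - z 0%N <= m%:R * w ->
  `|F 0%N x| <= A * (4 * B * w) ^+ m.
Proof.
move=> dF hz A0 B0 FM zx /andP[x0 xw].
apply: le_trans (hermite_bound dF hz FM zx) _.
rewrite ler_pdivrMr ?ltr0n ?fact_gt0 // -!mulrA ler_wpM2l //.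
have h : (x - z 0%N) ^+ m <= (m%:R * w) ^+ m.
  by rewrite lerXn2r ?nnegrE // (le_trans x0).
have w0 : 0 <= m%:R * w by rewrite (le_trans x0).
have wm0 : 0 <= w ^+ m.
  case: (m) w0 => [|m'] w0; first by rewrite expr0.
  by rewrite exprn_ge0 // -(pmulr_rge0 _ (ltr0Sn R m')).
apply: (@le_trans _ _ (B ^+ m * (m%:R * w) ^+ m)).
  by rewrite ler_wpM2l ?exprn_ge0.
have -> : (4 * (B * w)) ^+ m * m`!%:R = B ^+ m * ((4 ^ m * m`!)%:R * w ^+ m).
  by rewrite natrM natrX !exprMn; ring.
by rewrite ler_wpM2l ?exprn_ge0 // exprMn ler_wpM2r // -natrX ler_nat expnn_le_fact.
Qed.

End HermiteBound.


(** * Counting zeros by disjoint intervals and a mean value *)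

Section Counting.
Variable R : realType.
Implicit Types (z : nat -> R) (Phi : R -> R).

(* Greedily shifted copies of the [z i], at mutual distance at least [w]. *)
Fixpoint queue z (w : R) (i : nat) : R :=
  if i is i'.+1 then Num.max (z i) (queue z w i' + w) else z 0%N.

Lemma queue_ge z w i : z i <= queue z w i.
Proof. by case: i => [|i] //=; rewrite le_max lexx. Qed.

(** Here j starts the run of pushed points containing i, so the interval of length w at the i-th
    queued point ends within (i - j + 1) w of z j, as a cluster estimate requires. *)
Lemma queue_start z w i :
  exists2 j, (j <= i)%N & queue z w i = z j + (i - j)%:R * w.
Proof.
elim: i => [|i [j ji e]]; first by exists 0%N => //=; rewrite mul0r addr0.
rewrite /= /Num.max; case: ifP => _; last first.
  by exists i.+1 => //; rewrite subnn mul0r addr0.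
exists j; first exact: leqW.
by rewrite e subSn // -natr1 mulrDl mul1r addrA.
Qed.

(** At most L / (2 pi) + 1 periods cover [0, L], and the primitive is monotone. *)
Lemma has_mean_growth Phi (a L : R) Psi : der Psi Phi -> (forall t, 0 <= Phi t) ->
  (forall t, Psi (t + 2 * pi) = Psi t + 2 * pi * a) -> 0 <= L ->
  Psi L - Psi 0 <= (L + 2 * pi) * a.
Proof.
move=> dPsi Phi0 per L0.
have pi2 : 0 < 2 * pi :> R by rewrite mulr_gt0 ?pi_gt0.
have mono u v : u <= v -> Psi u <= Psi v by move=> uv; apply: der_mono dPsi _ uv.
have a0 : 0 <= a.
  rewrite -(pmulr_rge0 _ pi2) -(lerD2l (Psi 0)) addr0 -per mono //.
  by rewrite add0r ltW.
pose q := (Num.truncn (L / (2 * pi))).+1.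
have PsiN (n : nat) : Psi (n%:R * (2 * pi)) = Psi 0 + n%:R * (2 * pi * a).
  elim: n => [|n IH]; first by rewrite !mul0r addr0.
  by rewrite -natr1 mulrDl mul1r per IH; ring.
have Lq : L <= q%:R * (2 * pi).
  by rewrite -ler_pdivrMr // ltW // truncnS_gt.
have qL : q%:R * (2 * pi) <= L + 2 * pi.
  rewrite /q -natr1 mulrDl mul1r lerD2r -ler_pdivlMr // truncn_le //.
  by rewrite divr_ge0 // ltW.
rewrite lerBlDl; apply: le_trans (mono _ _ Lq) _; rewrite PsiN lerD2l.
by rewrite mulrA ler_wpM2r.
Qed.

(** Markov's inequality: the N intervals of length w at the queued points do not overlap, lie in E,
    where Phi >= 1, and stay within [0, 2 pi + N w]. *)
Lemma queue_count z N w Phi a (E : R -> Prop) : 0 <= w ->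
  (forall i, (i < N)%N -> 0 <= z i <= 2 * pi) ->
  (forall j i x, (j <= i)%N -> (i < N)%N -> z i <= x ->
     x <= z j + (i - j).+1%:R * w -> E x) ->
  (forall t, 0 <= Phi t) -> (forall t, E t -> 1 <= Phi t) -> has_mean Phi a ->
  N%:R * w <= (N%:R * w + 4 * pi) * a.
Proof.
move=> w0 zb zE Phi0 Phi1 [Psi dPsi per].
have mono u v : u <= v -> Psi u <= Psi v by move=> uv; apply: der_mono dPsi _ uv.
have Nw0 : 0 <= N%:R * w by rewrite mulr_ge0.
have pi0 := pi_gt0 R.
have L0 : 0 <= N%:R * w + 2 * pi by lra.
apply: le_trans (_ : _ <= (N%:R * w + 2 * pi + 2 * pi) * a) _; last first.
  by rewrite le_eqVlt; apply/orP; left; apply/eqP; ring.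
apply: le_trans (has_mean_growth dPsi Phi0 per L0).
case: N zb zE Nw0 L0 => [|N] zb zE Nw0 L0.
  by rewrite mul0r add0r subr_ge0 mono // mulr_ge0 // ltW.
have step i : (i < N.+1)%N -> w <= Psi (queue z w i + w) - Psi (queue z w i).
  move=> iN; rewrite -subr_ge0.
  pose g t := Psi t - t.
  have dg : der g (fun t => Phi t - 1).
    exact: derB dPsi (fun s => @is_derive_id _ _ s (1 : R)).
  have le_q : queue z w i <= queue z w i + w by rewrite lerDl.
  suff : g (queue z w i) <= g (queue z w i + w) by rewrite /g; lra.
  apply: (der_mono dg) le_q => x /andP[qx xq]; rewrite subr_ge0; apply: Phi1.
  have [j ji e] := queue_start z w i.
  apply: (zE j i) => //; first exact: le_trans (queue_ge z w i) qx.
  by apply: le_trans xq _; rewrite e -natr1 mulrDl mul1r addrA.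
have acc i : (i < N.+1)%N -> i.+1%:R * w <= Psi (queue z w i + w) - Psi 0.
  elim: i => [|i IH] iN.
    have /andP[z0 _] := zb 0%N isT.
    by have := step 0%N isT; have := mono _ _ z0; rewrite /= mul1r; lra.
  have := step _ iN; have := IH (ltnW iN).
  have : Psi (queue z w i + w) <= Psi (queue z w i.+1).
    by apply: mono; rewrite /= le_max lexx orbT.
  by rewrite -[i.+2%:R]natr1 mulrDl mul1r; lra.
apply: le_trans (acc N (ltnSn N)) _; rewrite lerD2r; apply: mono.
have [j jN ->] := queue_start z w N.
have /andP[_ zj] := zb j jN.
have : (N - j)%:R * w <= N%:R * w by rewrite ler_wpM2r // ler_nat leq_subr.
by rewrite -natr1 mulrDl mul1r; lra.
Qed.

End Counting.


(** * Zero counts at a level, for small and for large eta *)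

Section LevelZeros.
Variable R : realType.
Implicit Types (F : nat -> R -> R) (z : nat -> R).

Definition level_chain F (y : R) (m : nat) (t : R) : R :=
  if m is m'.+1 then F m t else F 0%N t - y.

Lemma deriv_level_chain F y : deriv_chain F -> deriv_chain (level_chain F y).
Proof.
move=> dF [|m] /=; last exact: dF.
by apply: der_eq (derB (dF 0%N) (der_cst y)) => t; rewrite subr0.
Qed.

Variables (F : nat -> R -> R) (n eta : R).
Hypotheses (n0 : 0 < n) (eta0 : 0 < eta) (eta1 : eta <= 1).
Hypothesis dF : deriv_chain F.
Hypothesis F_le : forall m t, `|F m t| <= 2 * n * (2 * n) ^+ m.
Hypothesis F_ge0 : forall t, 0 <= F 0%N t.
Hypothesis F1_le : forall t, F 1%N t ^+ 2 <= 8 * n ^+ 3 * F 0%N t.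

Variables (N : nat) (z : nat -> R).
Hypothesis z_bnd : forall i, (i < N)%N -> 0 <= z i <= 2 * pi.
Hypothesis z_zeros : has_zeros (level_chain F (eta * n)) z N.

Let cluster w j i x : (j <= i)%N -> (i < N)%N -> z i <= x ->
  x <= z j + (i - j).+1%:R * w ->
  `|F 0%N x - eta * n| <= 2 * n * (8 * n * w) ^+ (i - j).+1.
Proof.
move=> ji iN zx xw.
have hz : has_zeros (level_chain F (eta * n)) (fun l => z (j + l)%N) (i - j).+1.
  by apply: has_zeros_sub z_zeros _; rewrite addnS subnKC.
have mono := has_zeros_mono z_zeros.
have n2 : 0 <= 2 * n by rewrite mulr_ge0 // ltW.
have := @cluster_bound _ _ _ (i - j).+1 (2 * n) (2 * n) w x
  (deriv_level_chain (eta * n) dF) hz n2 n2.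
rewrite /= mulrA -[4 * 2]natrM; apply.
  - by move=> t; exact: F_le.
  - move=> l lij; apply: le_trans zx; apply: mono => //.
    by rewrite -leq_subRL // -ltnS.
  - rewrite addn0 subr_ge0 lerBlDl xw andbT.
    by apply: le_trans zx; exact: mono.
Qed.

Lemma sqrt_eta_props : [/\ 0 < Num.sqrt eta, Num.sqrt eta <= 1 &
  Num.sqrt eta ^+ 2 = eta].
Proof.
split; first by rewrite sqrtr_gt0.
  by rewrite -[leRHS]sqrtr1 ler_wsqrtr.
by rewrite sqr_sqrtr // ltW.
Qed.

Let small_window w j i x : w = Num.sqrt eta / (32 * n) ->
  (j <= i)%N -> (i < N)%N -> z i <= x -> x <= z j + (i - j).+1%:R * w ->
  F 0%N x <= 2 * eta * n.
Proof.
move=> wE ji iN zx xw.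
have [s0 s1 s2] := sqrt_eta_props.
set s := Num.sqrt eta in wE s0 s1 s2.
have nw : n * w = s / 32 by rewrite wE; field; rewrite gt_eqF.
have w0 : 0 < w by rewrite -(pmulr_rgt0 _ n0) nw divr_gt0.
have en0 : 0 < eta * n by rewrite mulr_gt0.
(* As 8 n w = sqrt eta / 4, two or more zeros bring the error down to 2n (eta / 16). *)
have [lt_ji|le_ij] := ltnP j i.
  have := cluster ji iN zx xw.
  have -> : 8 * n * w = s / 4 by rewrite -mulrA nw; field.
  have : (s / 4) ^+ (i - j).+1 <= (s / 4) ^+ 2.
    rewrite ler_wiXn2l ?ltnS ?subn_gt0 //; first by rewrite divr_ge0 // ltW.
    by lra.
  rewrite (expr_div_n _ _ 2) s2 => h1 h2.
  have : 2 * n * (s / 4) ^+ (i - j).+1 <= 2 * n * (eta / 4 ^+ 2).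
    by rewrite ler_wpM2l // mulr_ge0 // ltW.
  move: h2; rewrite ler_norml => /andP[_]; lra.
have eij : i = j by apply/eqP; rewrite eqn_leq le_ij.
subst j; rewrite subnn mul1r in xw.
(* A single zero: the generic cluster bound is only of order sqrt eta here, but
   [F 1 ^+ 2 <= 8 n^3 F 0] makes [F 0] flat where it is small. *)
have Fz : F 0%N (z i) = eta * n.
  have := z_zeros.2 i 0%N; rewrite addn0 => /(_ iN erefl) /= /eqP.
  by rewrite subr_eq0 => /eqP.
have := zx; rewrite le_eqVlt => /predU1P[<-|ltx]; first by rewrite Fz; lra.
have [c /andP[zc cx] Fx] := der_MVT (dF 0%N) ltx.
have [d /andP[zd dc] Fc] := der_MVT (dF 1%N) zc.
(* [F1_le] at a zero gives F 1 ^+ 2 <= 8 eta n^4, which is below 9 eta n^4. *)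
have F1z : `|F 1%N (z i)| <= 3 * n ^+ 2 * s.
  have n2s : 0 <= 3 * n ^+ 2 * s by rewrite ltW // !mulr_gt0 ?exprn_gt0.
  rewrite -(@ler_pXn2r _ 2) ?nnegrE //.
  rewrite real_normK ?num_real //; apply: le_trans (F1_le _) _.
  rewrite Fz !exprMn s2 -subr_ge0.
  have -> : 3 ^+ 2 * n ^+ 2 ^+ 2 * eta - 8 * n ^+ 3 * (eta * n) =
    eta * (n ^+ 2) ^+ 2 by ring.
  by rewrite ltW // mulr_gt0 ?exprn_gt0.
have F1c : F 1%N c <= 3 * n ^+ 2 * s + 8 * n ^+ 3 * w.
  have : F 1%N c = F 1%N (z i) + F 2%N d * (c - z i) by rewrite -Fc; ring.
  move=> ->; apply: lerD; first by apply: le_trans (ler_norm _) F1z.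
  apply: (@le_trans _ _ (8 * n ^+ 3 * (c - z i))).
    rewrite ler_wpM2r ?subr_ge0 ?(ltW zc) //; apply: le_trans (ler_norm _) _.
    by apply: le_trans (F_le 2 d) _; rewrite le_eqVlt; apply/orP; left; apply/eqP; ring.
  rewrite ler_wpM2l //; first by rewrite ltW // mulr_gt0 ?exprn_gt0.
  by move: ltx cx xw; lra.
have -> : F 0%N x = eta * n + F 1%N c * (x - z i) by rewrite -Fx Fz; ring.
have : F 1%N c * (x - z i) <= (3 * n ^+ 2 * s + 8 * n ^+ 3 * w) * w.
  apply: (@le_trans _ _ ((3 * n ^+ 2 * s + 8 * n ^+ 3 * w) * (x - z i))).
    by rewrite ler_wpM2r ?subr_ge0 ?(ltW ltx).
  rewrite ler_wpM2l; first by [].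
    by rewrite ltW // addr_gt0 // !mulr_gt0 ?exprn_gt0.
  by rewrite lerBlDl.
have -> : (3 * n ^+ 2 * s + 8 * n ^+ 3 * w) * w = 13 / 128 * (eta * n).
  rewrite -s2; have -> : (3 * n ^+ 2 * s + 8 * n ^+ 3 * w) * w =
    n * (3 * s * (n * w) + 8 * (n * w) ^+ 2) by ring.
  by rewrite nw; field.
by lra.
Qed.

(** Where F 0 <= 2 eta n, Bernoulli gives (T / 2n)^M >= (1 - eta)^M >= 1 - M eta >= 1/2, so twice
    this power is the test function for [queue_count], of mean at most 5 eta <= 1/2. Absorbing N w /
    2 leaves N w <= 40 pi eta. *)
Lemma zeros_small (T : R -> R) (M : nat) (a : R) :
  (forall t, F 0%N t + T t = 2 * n) -> (forall t, 0 <= T t) ->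
  M%:R * eta <= 2^-1 -> eta <= 10^-1 ->
  has_mean (fun t => (T t / (2 * n)) ^+ M) a -> a <= 5 / 2 * eta ->
  N%:R <= 1280 * pi * Num.sqrt eta * n.
Proof.
move=> FT T0 Meta eta10 meanT a_le.
have [s0 s1 s2] := sqrt_eta_props.
have n2 : 0 < 2 * n by rewrite mulr_gt0.
pose w := Num.sqrt eta / (32 * n).
have w0 : 0 < w by rewrite divr_gt0 // mulr_gt0.
have bernoulli (k : nat) : 1 - k%:R * eta <= (1 - eta) ^+ k.
  elim: k => [|k IH]; first by rewrite mul0r subr0 expr0.
  rewrite exprS; apply: (@le_trans _ _ ((1 - eta) * (1 - k%:R * eta))).
    have : 0 <= k%:R * eta * eta by rewrite !mulr_ge0 ?(ltW eta0).
    by rewrite -natr1; lra.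
  by rewrite ler_wpM2l // subr_ge0.
have Nw : N%:R * w <= (N%:R * w + 4 * pi) * (2 * a).
  apply: (@queue_count R z N w (fun t => 2 * (T t / (2 * n)) ^+ M) (2 * a)
    (fun x => F 0%N x <= 2 * eta * n) (ltW w0) z_bnd).
  - by move=> j i x ji iN zx xw; exact: small_window xw.
  - by move=> t; rewrite mulr_ge0 // exprn_ge0 // divr_ge0 // ltW.
  - move=> t Et; have : 1 - eta <= T t / (2 * n).
      by rewrite ler_pdivlMr //; have := FT t; lra.
    move=> h; have : (1 - eta) ^+ M <= (T t / (2 * n)) ^+ M.
      by rewrite lerXn2r ?nnegrE ?subr_ge0 // (le_trans _ h) ?subr_ge0.
    by have := bernoulli M; lra.
  - exact: has_meanZ.
have pi0 := pi_gt0 R; have Nw0 : 0 <= N%:R * w by rewrite mulr_ge0 // ltW.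
have : N%:R * w <= (N%:R * w + 4 * pi) * (5 * eta).
  apply: le_trans Nw _; rewrite ler_wpM2l //; lra.
have : N%:R * w * eta <= N%:R * w * 10^-1 by rewrite ler_wpM2l.
move=> h1 h2; have : N%:R * w <= 40 * pi * eta by lra.
rewrite -ler_pdivlMr //.
suff -> : 40 * pi * eta / w = 1280 * pi * Num.sqrt eta * n by [].
rewrite /w; move: (Num.sqrt eta) s0 s2 => s s0 <-.
by field; rewrite !gt_eqF.
Qed.

(** A bound O(n) is enough for eta away from 0, so a quadratic test function serves: Phi is at least
    1 for F 0 within n / 4 of the level, positive elsewhere, and of mean at most 15/16. Absorption
    then gives N w <= 60 pi. *)
Lemma zeros_large (a1 a2 : R) :
  (forall t, F 0%N t <= 2 * n) ->
  has_mean (fun t => (F 0%N t / (2 * n)) ^+ 1) a1 ->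
  has_mean (fun t => (F 0%N t / (2 * n)) ^+ 2) a2 ->
  5 / 16 <= 4 * a2 - 4 * eta * a1 + eta ^+ 2 ->
  N%:R <= 3840 * pi * n.
Proof.
move=> F2n m1 m2 a_le.
pose w := (64 * n)^-1.
have w0 : 0 < w by rewrite invr_gt0 mulr_gt0.
pose u t := F 0%N t / (2 * n).
pose Phi t := (65 / 64 - eta ^+ 2 / 4) + (eta * u t ^+ 1 + - 1 * u t ^+ 2).
have PhiE t : Phi t = 1 + (1 / 16 - (2 * u t - eta) ^+ 2) / 4.
  by rewrite /Phi expr1; field.
have mPhi : has_mean Phi ((65 / 64 - eta ^+ 2 / 4) + (eta * a1 + - 1 * a2)).
  by apply: has_meanD (has_mean_cst _) _; apply: has_meanD; apply: has_meanZ.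
have n2 : 0 < 2 * n by rewrite mulr_gt0.
have u01 t : 0 <= u t <= 1.
  by rewrite divr_ge0 ?(ltW n2) //= ler_pdivrMr // mul1r.
have Nw := @queue_count R z N w Phi _
  (fun x => `|F 0%N x - eta * n| <= n / 4) (ltW w0) z_bnd _ _ _ mPhi.
have {}Nw : N%:R * w <= (N%:R * w + 4 * pi)
    * ((65 / 64 - eta ^+ 2 / 4) + (eta * a1 + - 1 * a2)).
  apply: Nw.
  - move=> j i x ji iN zx xw; apply: le_trans (cluster ji iN zx xw) _.
    have -> : 8 * n * w = 8^-1 by rewrite /w; field; rewrite gt_eqF.
    have : (8^-1 : R) ^+ (i - j).+1 <= 8^-1.
      by rewrite -[leRHS]expr1 ler_wiXn2l //; lra.
    move=> h; have : 2 * n * 8^-1 ^+ (i - j).+1 <= 2 * n * 8^-1.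
      by rewrite ler_wpM2l // ltW.
    by lra.
  - move=> t; rewrite PhiE; have /andP[u0 u1] := u01 t.
    have : 0 <= (2 - (2 * u t - eta)) * (2 + (2 * u t - eta)).
      by have e0 := eta0; have e1 := eta1; apply: mulr_ge0; lra.
    have -> : (2 - (2 * u t - eta)) * (2 + (2 * u t - eta)) =
      4 - (2 * u t - eta) ^+ 2 by ring.
    by lra.
  - move=> t Et; rewrite PhiE.
    have : `|2 * u t - eta| <= 1 / 4.
      have -> : 2 * u t - eta = (F 0%N t - eta * n) / n.
        by rewrite /u; field; rewrite gt_eqF.
      by rewrite normrM [`|n^-1|]gtr0_norm ?invr_gt0 // ler_pdivrMr //; lra.
    by rewrite ler_norml => /andP[]; nra.
have pi0 := pi_gt0 R; have Nw0 : 0 <= N%:R * w by rewrite mulr_ge0 // ltW.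
have : N%:R * w <= (N%:R * w + 4 * pi) * (15 / 16).
  apply: le_trans Nw _; rewrite ler_wpM2l //; lra.
move=> h; have : N%:R * w <= 60 * pi by lra.
rewrite -ler_pdivlMr //.
suff -> : 60 * pi / w = 3840 * pi * n by [].
by rewrite /w; field; rewrite !gt_eqF.
Qed.

End LevelZeros.


(** * Level zeros of the Rudin-Shapiro squared moduli *)

Section RudinLevelZeros.
Variable R : realType.
Local Notation C := R[i].

Lemma null_near (u : nat -> R) (e : R) : null u -> 0 < e ->
  exists k0, forall k, (k0 <= k)%N -> `|u k| < e.
Proof.
by move=> /cvgr0Pnorm_lt h e0; have [k0 _ hk] := h e e0; exists k0.
Qed.

Lemma rudin_moments (p : nat -> {poly C}) (m : nat) :
  p = rudinP C \/ p = rudinQ C ->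
  exists2 a, null (fun k => a k - m.+1%:R^-1) &
    forall k, has_mean (fun t => (sqmod_circle (p k) t / 2 ^+ k.+1) ^+ m) (a k).
Proof.
case=> ->.
  exists (fun k => corr R m k 0 ord0 ord0); first exact: corr0_lim_first.
  by move=> k; have [] := @has_mean_moments R m k.
exists (fun k => corr R m k 0 ord_max ord_max); first exact: corr0_lim_last.
by move=> k; have [] := @has_mean_moments R m k.
Qed.

(** Zeros are counted through nondecreasing lists with repetitions, the form that the Hermite
    argument handles. *)
Definition level_zeros_le (f : R -> R) (y B : R) :=
  exists F : nat -> R -> R, [/\ deriv_chain F, F 0%N = f &
    forall N z, (forall i, (i < N)%N -> 0 <= z i <= 2 * pi) ->
      has_zeros (level_chain F y) z N -> N%:R <= B].

Lemma rudin_zeros_bound (p q : nat -> {poly C}) (eta : R) :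
  (p = rudinP C /\ q = rudinQ C) \/ (p = rudinQ C /\ q = rudinP C) ->
  0 < eta -> eta <= 1 ->
  exists k0, forall k, (k0 <= k)%N -> level_zeros_le (sqmod_circle (p k))
    (eta * 2 ^+ k) (15360 * pi * Num.sqrt eta * 2 ^+ k).
Proof.
move=> pq eta0 eta1.
have pPQ : p = rudinP C \/ p = rudinQ C by case: pq => -[]; [left|right].
have qPQ : q = rudinP C \/ q = rudinQ C by case: pq => -[]; [right|left].
have pqD k t : sqmod_circle (p k) t + sqmod_circle (q k) t = 2 * 2 ^+ k.
  by rewrite -exprS -(sqmod_rudin_add k t); case: pq => -[-> ->] //; rewrite addrC.
have chain k := @rudin_chain R k (p k) ltac:(by case: pPQ => ->; [left|right]).
have n0 k : 0 < 2 ^+ k :> R by rewrite exprn_gt0.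
have pi0 := pi_gt0 R.
have [s0 s1 s2] := sqrt_eta_props eta0 eta1.
have [small|large] := leP eta 10^-1.
(* This M gives both M eta <= 1/2 and 1 / (M + 1) <= 2 eta; for large k the M-th moment exceeds its
   limit by less than eta / 2. *)
- pose M := Num.truncn ((2 * eta)^-1).
  have e2 : 0 < (2 * eta)^-1 by rewrite invr_gt0 mulr_gt0.
  have Meta : M%:R * eta <= 2^-1.
    have : M%:R <= (2 * eta)^-1 by rewrite truncn_le // ltW.
    by rewrite -(ler_pM2r eta0) invfM mulfVK // gt_eqF.
  have Meta' : M.+1%:R^-1 <= 2 * eta.
    rewrite invf_ple ?posrE ?mulr_gt0 //; exact/ltW/truncnS_gt.
  have [a a_lim a_mean] := rudin_moments M qPQ.
  have eta2 : 0 < eta / 2 by rewrite divr_gt0.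
  have [k0 hk0] := null_near a_lim eta2.
  exists k0 => k kk0; have [F [dF F0 F_le F1_le]] := chain k.
  rewrite exprS in F_le.
  exists F; split=> // N z zb hz.
  have F_ge0 t : 0 <= F 0%N t by rewrite F0 sqmod_circle_ge0.
  have a_le : a k <= 5 / 2 * eta.
    have := hk0 k kk0; rewrite ltr_norml => /andP[_].
    by move: M.+1%:R^-1 Meta' => u; lra.
  have ak := a_mean k; rewrite exprS in ak.
  have FT t : F 0%N t + sqmod_circle (q k) t = 2 * 2 ^+ k by rewrite F0.
  have := zeros_small (n0 k) eta0 eta1 dF F_le F1_le zb hz FT
    (sqmod_circle_ge0 (q k)) Meta small ak a_le.
  move=> h; apply: le_trans h _.
  rewrite ler_wpM2r ?(ltW (n0 k)) // ler_wpM2r ?(ltW s0) // ler_wpM2r ?(ltW pi0) //.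
  by lra.
have [a1 a1_lim a1_mean] := rudin_moments 1 pPQ.
have [a2 a2_lim a2_mean] := rudin_moments 2 pPQ.
(* With the limits 1/2 and 1/3 of the moments, the quantity to bound is (eta - 1)^2 + 1/3; the
   errors, at most 8/400, fit into 1/3 - 5/16 = 1/48. *)
have e0 : 0 < 400^-1 :> R by rewrite invr_gt0 ltr0n.
have [k1 hk1] := null_near a1_lim e0; have [k2 hk2] := null_near a2_lim e0.
exists (maxn k1 k2) => k; rewrite geq_max => /andP[/hk1 h1 /hk2 h2].
have [F [dF F0 F_le F1_le]] := chain k.
rewrite exprS in F_le.
exists F; split=> // N z zb hz.
have F_ge0 t : 0 <= F 0%N t by rewrite F0 sqmod_circle_ge0.
have F2n t : F 0%N t <= 2 * 2 ^+ k.
  by rewrite -(pqD k t) F0 lerDl sqmod_circle_ge0.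
have m1 := a1_mean k; have m2 := a2_mean k; rewrite exprS -F0 in m1 m2.
have a_le : 5 / 16 <= 4 * a2 k - 4 * eta * a1 k + eta ^+ 2.
  move: h1 h2; rewrite !ltr_norml => /andP[_ h1] /andP[h2 _].
  have : eta * a1 k <= eta * (2^-1 + 400^-1).
    by rewrite ler_wpM2l ?(ltW eta0) //; lra.
  have : 0 <= (eta - 1) ^+ 2 by rewrite sqr_ge0.
  by rewrite sqrrB expr1n mulr1 -[eta *+ 2]mulr_natr; lra.
have := zeros_large (n0 k) eta0 eta1 dF F_le F_ge0 zb hz F2n m1 m2 a_le.
move=> h; apply: le_trans h _; rewrite ler_wpM2r ?(ltW (n0 k)) //.
(* Since eta > 1/10 > 1/16, the missing factor sqrt eta costs at most 4, and 15360 = 4 * 3840. *)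
have s4 : 4^-1 <= Num.sqrt eta.
  rewrite -(@ler_pXn2r _ 2) ?nnegrE ?(ltW s0) // s2; lra.
have : pi * 4^-1 <= pi * Num.sqrt eta by rewrite ler_wpM2l ?(ltW pi0).
by lra.
Qed.

End RudinLevelZeros.

(** * From lists of zeros to the number of solutions *)

Section SolutionCount.
Variable R : realType.

Lemma deriv_chain_derive1n (F : nat -> R -> R) : deriv_chain F ->
  forall j, derive1n j (F 0%N) = F j.
Proof.
move=> dF; elim=> [|j IH]; first by [].
by rewrite derive1nS IH; apply/funext => t; rewrite derive1E; have [] := dF j t.
Qed.

Lemma count_flatten_nseq (s : seq R) (mu : R -> nat) t : uniq s ->
  (count_mem t (flatten [seq nseq (mu x) x | x <- s]) <= mu t)%N.
Proof.
elim: s => [|x s IH] //= /andP[xs us]; rewrite count_cat count_nseq /=.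
have [e|xt] := eqVneq x t; last by rewrite mul0n add0n IH.
subst t.
rewrite mul1n; suff -> : count_mem x (flatten [seq nseq (mu y) y | y <- s]) = 0%N.
  by rewrite addn0.
apply/eqP; rewrite -leqn0 leqNgt -has_count has_pred1.
apply/flattenP => -[_ /mapP[y ys ->]]; rewrite mem_nseq => /andP[_ /eqP xy].
by rewrite xy ys in xs.
Qed.

(** In a sorted list, equal entries at i and i + j enclose j + 1 equal ones, so the multiplicity
    there exceeds j. *)
Lemma has_zeros_sort (G : nat -> R -> R) (s : seq R) (mu : R -> nat) :
  uniq s -> (forall t j, t \in s -> (j < mu t)%N -> G j t = 0) ->
  let l := sort <=%R (flatten [seq nseq (mu x) x | x <- s]) in
  has_zeros G (nth 0 l) (size l).
Proof.
move=> us Gmu l.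
have sl : sorted <=%R l by rewrite sort_sorted //; exact: le_total.
have mem_l t : t \in l -> t \in s.
  rewrite mem_sort => /flattenP[_ /mapP[y ys ->]].
  by rewrite mem_nseq => /andP[_ /eqP ->].
split=> [i il|i j ijl e].
  by rewrite (sorted_leq_nth le_trans lexx) ?inE //; exact: ltnW.
have il : (i < size l)%N by apply: leq_ltn_trans ijl; rewrite leq_addr.
apply: Gmu; first by rewrite mem_l // mem_nth.
apply: leq_trans (count_flatten_nseq _ _ us).
rewrite -(count_sort <=%R) -/l.
pose d := take j.+1 (drop i l).
have sd : size d = j.+1.
  by rewrite size_takel // size_drop ltn_subRL.
apply: (@leq_trans (count_mem (nth 0 l i) d)); last first.
  rewrite -[X in (_ <= count _ X)%N](cat_take_drop i l) count_cat.
  rewrite -[X in (_ <= _ + count _ X)%N](cat_take_drop j.+1 (drop i l)).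
  by rewrite count_cat addnCA leq_addr.
suff : all (pred1 (nth 0 l i)) d by rewrite all_count sd => /eqP ->.
apply/(all_nthP 0) => m; rewrite sd => mj /=.
rewrite nth_take // nth_drop eq_le.
have mono a b : (a <= b)%N -> (b < size l)%N -> l`_a <= l`_b.
  move=> ab bl; apply: (sorted_leq_nth le_trans lexx) => //; rewrite inE //.
  exact: leq_ltn_trans bl.
by rewrite {1}e !mono //; lia.
Qed.

(** The sum is a supremum over finite sets of solutions. Capping multiplicities at K > B makes the
    list of repeated points finite; its length is then at most B, so the cap is never reached. *)
Lemma nb_solutions_le (f : R -> R) (y B : R) : level_zeros_le f y B ->
  (nb_solutions f y <= B%:E)%E.
Proof.
move=> [F [dF <- bound]]; pose G := level_chain F y.
have B0 : 0 <= B by apply: (bound 0%N (fun=> 0)) => //; split.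
pose K := (Num.truncn B).+1.
have BK : B < K%:R by exact: truncnS_gt.
(* The multiplicity of [t], capped at [K]. *)
pose mu t := find (fun j => G j t != 0) (iota 0 K).
have mu_zero t j : (j < mu t)%N -> G j t = 0.
  move=> jm; have jK : (j < K)%N.
    by apply: leq_trans jm _; rewrite -[leqRHS](size_iota 0) find_size.
  by have /negbFE/eqP := before_find 0%N jm; rewrite nth_iota // add0n.
have mu_mult t : (mu t < K)%N ->
    (zero_mult (fun s => F 0%N s - y)%R t <= (mu t)%:R%:E)%E.
  move=> muK; apply: ereal_inf_lbound; exists (mu t) => //=.
  rewrite (@deriv_chain_derive1n G (deriv_level_chain y dF)).
  have : has (fun j => G j t != 0) (iota 0 K) by rewrite has_find size_iota.
  by move=> /(nth_find 0%N); rewrite nth_iota.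
apply: ub_ereal_sup => _ [X [finX XS] <-].
pose s : seq R := finmap.enum_fset (fset_set X).
have memX t : t \in s -> 0 <= t < 2 * pi /\ F 0%N t = y.
  by move=> ts; apply: XS; have := in_fset_set finX t; rewrite ts => /esym/set_mem.
rewrite fsbig_finite //=.
have us : uniq s := finmap.fset_uniq _.
pose l := sort <=%R (flatten [seq nseq (mu x) x | x <- s]).
have hz : has_zeros G (nth 0 l) (size l).
  by apply: has_zeros_sort us _ => t j _; exact: mu_zero.
have sizeE : size l = (\sum_(x <- s) mu x)%N.
  rewrite size_sort size_flatten sumnE /shape -map_comp big_map.
  by apply: eq_bigr => x _; rewrite /= size_nseq.
have muB : (\sum_(x <- s) mu x)%N%:R <= B.
  rewrite -sizeE; apply: bound hz => i /(mem_nth 0).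
  rewrite mem_sort => /flattenP[_ /mapP[x xs ->]].
  rewrite mem_nseq => /andP[_ /eqP ->].
  by have [/andP[-> /ltW ->] _] := memX x xs.
apply: le_trans (_ : _ <= \sum_(x <- s) (mu x)%:R%:E)%E _; last first.
  by rewrite sumEFin -natr_sum lee_fin.
rewrite big_seq [leRHS]big_seq; apply: lee_sum => x xs; apply: mu_mult.
rewrite -(ltr_nat R); apply: le_lt_trans BK; apply: le_trans muB.
by rewrite ler_nat (big_rem x) //= leq_addr.
Qed.

(** As f = c - g, the derivatives differ only in sign and the zeros keep their multiplicities. *)
Lemma level_zeros_le_reflect (f g : R -> R) (c y B : R) :
  (forall t, f t + g t = c) -> level_zeros_le g (c - y) B ->
  level_zeros_le f y B.
Proof.
move=> fg [F [dF F0 bound]].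
pose F' m t := if m is 0 then f t else - F m t.
have dN m : der (fun t => - F m t) (fun t => - F m.+1 t).
  under eq_fun do rewrite -mulN1r.
  by apply: der_eq (derZ (-1) (dF m)) => t; rewrite mulN1r.
exists F'; split=> //.
  case=> [|m]; last exact: dN.
  have -> : F' 0%N = fun t => c + - F 0%N t.
    by apply/funext => t; rewrite /F' F0 -(fg t) addrK.
  by apply: der_eq (derD (der_cst c) (dN 0%N)) => t; rewrite add0r.
move=> N z zb [zS z0]; apply: bound zb _; split=> // i j ijN e.
have := z0 i j ijN e; case: j {ijN e} => [|j] /=.
  by rewrite F0 => h; have := fg (z i); lra.
by move=> /eqP; rewrite oppr_eq0 => /eqP.
Qed.

End SolutionCount.

(** * Levels up to n directly, levels above n through the companion polynomial *)

Theorem theorem2p4 (R : realType) :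
  exists c : R, 0 < c /\
    forall Rk : nat -> R -> R,
      (Rk = fun k => sqmod_circle (rudinP R[i] k)) \/
      (Rk = fun k => sqmod_circle (rudinQ R[i] k)) ->
      (forall eta : R, 0 < eta -> eta <= 1 ->
         exists k_eta : nat, forall k : nat, (k_eta <= k)%N ->
           (nb_solutions (Rk k) (eta * 2 ^+ k)
              <= (c * Num.sqrt eta * 2 ^+ k)%:E)%E) /\
      (forall eta : R, 1 <= eta -> eta < 2 ->
         exists k_eta : nat, forall k : nat, (k_eta <= k)%N ->
           (nb_solutions (Rk k) (eta * 2 ^+ k)
              <= (c * Num.sqrt (2 - eta) * 2 ^+ k)%:E)%E).
Proof.
exists (15360 * pi); split; first by rewrite mulr_gt0 ?ltr0n ?pi_gt0.
suff main (p q : nat -> {poly R[i]}) :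
    (p = rudinP R[i] /\ q = rudinQ R[i]) \/ (p = rudinQ R[i] /\ q = rudinP R[i]) ->
    (forall eta : R, 0 < eta -> eta <= 1 ->
       exists k_eta : nat, forall k : nat, (k_eta <= k)%N ->
         (nb_solutions (sqmod_circle (p k)) (eta * 2 ^+ k)
            <= (15360 * pi * Num.sqrt eta * 2 ^+ k)%:E)%E) /\
    (forall eta : R, 1 <= eta -> eta < 2 ->
       exists k_eta : nat, forall k : nat, (k_eta <= k)%N ->
         (nb_solutions (sqmod_circle (p k)) (eta * 2 ^+ k)
            <= (15360 * pi * Num.sqrt (2 - eta) * 2 ^+ k)%:E)%E).
  by move=> Rk [->|->]; [exact: main (or_introl (conj erefl erefl))
                        |exact: main (or_intror (conj erefl erefl))].
move=> pq; split=> eta eta_lo eta_hi.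
  have [k0 hk0] := rudin_zeros_bound pq eta_lo eta_hi.
  by exists k0 => k /hk0; exact: nb_solutions_le.
have qp : (q = rudinP R[i] /\ p = rudinQ R[i]) \/ (q = rudinQ R[i] /\ p = rudinP R[i]).
  by case: pq => -[-> ->]; [right|left].
have e0 : 0 < 2 - eta by rewrite subr_gt0.
have e1 : 2 - eta <= 1 by lra.
have [k0 hk0] := rudin_zeros_bound qp e0 e1.
exists k0 => k /hk0 h; apply: nb_solutions_le.
apply: (@level_zeros_le_reflect _ _ (sqmod_circle (q k)) (2 * 2 ^+ k)).
  move=> t; rewrite -exprS -(sqmod_rudin_add k t).
  by case: pq => -[-> ->] //; rewrite addrC.
by rewrite -mulrBl.
Qed.
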